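(* Let $\alpha_1,\alpha_2,\beta_1,\beta_2,\gamma\in\widehat{\mathbb{F}_q^\times}$. (i) Suppose $\varepsilon\notin\{\alpha_1,\alpha_2,\beta_2,\overline{\beta_1\beta_2}\gamma\}$. Then for every $\lambda\in\mathbb{F}_q$, $$F_3\!\left({\alpha_1,\alpha_2;\beta_1,\beta_2\atop\gamma};\lambda,1\right)=\frac{g^\circ(\gamma)g(\overline{\alpha_2\beta_2}\gamma)}{g^\circ(\overline{\alpha_2}\gamma)g^\circ(\overline{\beta_2}\gamma)}\,{}_3F_2\!\left({\alpha_1,\beta_1,\overline{\alpha_2\beta_2}\gamma\atop\overline{\alpha_2}\gamma,\overline{\beta_2}\gamma};\lambda\right).$$ (ii) Suppose $\varepsilon\notin\{\alpha_1,\alpha_2,\beta_1,\beta_2,\overline{\alpha_1\alpha_2}\gamma\}$. Then for $\lambda\in\mathbb{F}_q$, $\lambda\neq1$, $$F_3\!\left({\alpha_1,\alpha_2;\beta_1,\beta_2\atop\gamma};\lambda,\frac{\lambda}{\lambda-1}\right)=\frac{g(\alpha_1\alpha_2\overline{\gamma})g(\alpha_2\beta_1\overline{\gamma})g(\overline{\beta_2})}{g(\overline{\gamma})g^\circ(\alpha_1\alpha_2\beta_1\overline{\gamma})g^\circ(\alpha_2\overline{\beta_2})}\,\overline{\gamma}(\lambda)\alpha_2(1-\lambda)\,{}_3F_2\!\left({\alpha_1\alpha_2\overline{\gamma},\alpha_2\beta_1\overline{\gamma},\overline{\beta_2}\atop\alpha_1\alpha_2\beta_1\overline{\gamma},\alpha_2\overline{\beta_2}};1-\lambda\right).$$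 (iii) Suppose $p\neq2$, $\varepsilon\notin\{\beta_1^2,\beta_2^2\}$ and $(\beta_1\beta_2)^2,(\beta_1\overline{\beta_2})^2\notin\{\gamma^2,\overline{\gamma}^2\}$. Then for $\lambda\in\mathbb{F}_q$, $\lambda\neq\pm1$, $$F_3\!\left({\beta_1^2,\beta_2^2;\overline{\beta_1}^2,\overline{\beta_2}^2\atop\gamma^2};\frac{\lambda}{\lambda+1},\frac{\lambda}{\lambda-1}\right)=\overline{\beta_2^2\gamma^2}(1+\lambda)\,\beta_2^2(1-\lambda)\sum_{\gamma'\in\{\gamma,\gamma\phi\}}{}_2F_1\!\left({\overline{\beta_1}\beta_2\gamma',\beta_1\beta_2\gamma'\phi\atop\gamma^2};\frac{4\lambda}{(\lambda+1)^2}\right).$$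
   Context: $\mathbb{F}_q$ is a finite field with $q$ elements and characteristic $p$. $\widehat{\mathbb{F}_q^\times}$ is the group of multiplicative characters $\mathbb{F}_q^\times\to\overline{\mathbb{Q}}^\times$, $\varepsilon$ the trivial character, $\phi$ the quadratic character (only when $p\ne 2$); every character (including $\varepsilon$) is extended by $0$ at $0$; $\overline{\eta}=\eta^{-1}$, and $\overline{\eta_1\eta_2}=(\eta_1\eta_2)^{-1}$; $\delta(\eta)=1$ if $\eta=\varepsilon$, else $0$. $\psi$ is a fixed non-trivial additive character. $g(\eta)=-\sum_{x\in\mathbb{F}_q^\times}\psi(x)\eta(x)$, $g^\circ(\eta)=q^{\delta(\eta)}g(\eta)$, $(\alpha)_\nu=g(\alpha\nu)/g(\alpha)$, $(\alpha)^\circ_\nu=g^\circ(\alpha\nu)/g^\circ(\alpha)$. For $\lambda\in\mathbb{F}_q$, ${}_mF_n\!\left({\alpha_1,\dots,\alpha_m\atop\beta_1,\dots,\beta_n};\lambda\right)=\frac{1}{1-q}\sum_{\nu}\frac{\prod_i(\alpha_i)_\nu}{(\varepsilon)^\circ_\nu\prod_j(\beta_j)^\circ_\nu}\nu(\lambda)$; Appell's function: for $x,y\in\mathbb{F}_q$, $F_3\!\left({\alpha_1,\alpha_2;\beta_1,\beta_2\atop\gamma};x,y\right)=\frac{1}{(1-q)^2}\sum_{\nu_1,\nu_2}\frac{(\alpha_1)_{\nu_1}(\alpha_2)_{\nu_2}(\beta_1)_{\nu_1}(\beta_2)_{\nu_2}}{(\gamma)^\circ_{\nu_1\nu_2}(\varepsilon)^\circ_{\nu_1}(\varepsilon)^\circ_{\nu_2}}\nu_1(x)\nu_2(y)$,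 sums over characters. *)

(* Defs.v *)
(* finite field F, characters of F^x = irreducible (hence
   linear) characters of the finite abelian group [set: {unit F}], valued in algC. *)
From HB Require Import structures.
From mathcomp Require Import all_boot all_order all_algebra all_fingroup all_solvable all_field all_character.
Set Implicit Arguments. Unset Strict Implicit. Unset Printing Implicit Defensive.
Import Order.TTheory GRing.Theory Num.Theory.
Local Open Scope ring_scope.

Section FFHyp.
Variable F : finFieldType.

Definition Fx : {group {unit F}} := [set: {unit F}]%G.

Definition chev (eta : 'CF(Fx)) (x : F) : algC :=
  match insub x : option {unit F} with Some u => eta u | None => 0 end.

Definition qC : algC := (#|F|)%:R.

Definition delta (eta : 'CF(Fx)) : nat := nat_of_bool (eta == 1).

Definition nontriv_add_char (psi : F -> algC) : Prop :=
  (forall x y, psi (x + y) = psi x * psi y) /\ (exists x, psi x != 1).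

Variable psi : F -> algC.

Definition gauss (eta : 'CF(Fx)) : algC :=
  - \sum_(x : F | x != 0) psi x * chev eta x.

Definition gauss0 (eta : 'CF(Fx)) : algC := qC ^+ delta eta * gauss eta.

Definition poch (a nu : 'CF(Fx)) : algC := gauss (a * nu) / gauss a.
Definition poch0 (a nu : 'CF(Fx)) : algC := gauss0 (a * nu) / gauss0 a.

Definition hypF (as_ bs : seq 'CF(Fx)) (lam : F) : algC :=
  (1 - qC)^-1 * \sum_(i : Iirr Fx)
     (\prod_(a <- as_) poch a 'chi_i) /
     (poch0 1 'chi_i * \prod_(b <- bs) poch0 b 'chi_i) * chev 'chi_i lam.

Definition appellF3 (a1 a2 b1 b2 c : 'CF(Fx)) (x y : F) : algC :=
  ((1 - qC) ^+ 2)^-1 * \sum_(i : Iirr Fx) \sum_(j : Iirr Fx)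
    (poch a1 'chi_i * poch a2 'chi_j * poch b1 'chi_i * poch b2 'chi_j) /
    (poch0 c ('chi_i * 'chi_j) * poch0 1 'chi_i * poch0 1 'chi_j)
    * chev 'chi_i x * chev 'chi_j y.

End FFHyp.

(* quadratic character phi: the character of F^x equal to 1 on nonzero squares
   and -1 on non-squares (meaningful when the characteristic is odd) *)
Definition quad_char (F : finFieldType) : 'CF(Fx F) :=
  match [pick i : Iirr (Fx F) | [forall u : {unit F},
      'chi_i u == (if [exists y : F, y ^+ 2 == val u] then 1 else -1)]] with
  | Some i => 'chi_i
  | None => 0
  end.

(* Main.v *)
(** (i) Summing F_3 at y = 1 over the second character is the finite-field
    Gauss summation formula, which follows from writing ratios of Gauss sums as
    Jacobi sums and using orthogonality of characters.

    (ii), (iii) Writing 1 / g0 (c nu1 nu2) as a Gauss sum separates the two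
    characters and turns F_3 into a sum over t of psi(-t) c^-1(t) times two
    confluent sums of the form sum_r psi(tr/x) a(tr/x) b^-1(r - 1).
    In (ii), 1/x + 1/y = 1; the sum over t is a Gauss sum, and the remaining
    double sum is a multiplicative convolution of three Jacobi sums, that is,
    a 3F2.
    In (iii), b = a^-1 and again 1/x + 1/y = 1; completing the square, each
    confluent sum is psi(t/2x) times a Bessel-type sum of a(s^2 - 1), which is a
    twisted Kloosterman sum in t^2.  The factors psi cancel, so the summand
    depends on t^2 only, and sum_t f(t^2) = sum_u (1 + phi(u)) f(u) produces
    the two terms gamma and gamma phi.  Each of them is an Euler integral of a
    2F1, brought to its final form by shifting the summation character by
    gamma^2. *)
Require Import Defs.
From HB Require Import structures.
From mathcomp Require Import all_boot all_order all_algebra all_fingroup all_solvable all_field all_character.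
From mathcomp Require Import ring.
Import Order.TTheory GRing.Theory Num.Theory.
Local Open Scope ring_scope.

Set Implicit Arguments. Unset Strict Implicit. Unset Printing Implicit Defensive.

(** * Characters of the unit group extended by zero, and their orthogonality relations *)

Section Characters.
Variable F : finFieldType.
Implicit Types (a b : 'CF(Fx F)) (x y z : F).
Local Notation q := (qC F).

Lemma chi_lin (i : Iirr (Fx F)) : 'chi_i \is a linear_char.
Proof. exact/irr_cyclic_lin/field_unit_group_cyclic. Qed.

Lemma chiM_lin a b : a \is a linear_char -> b \is a linear_char -> a * b \is a linear_char.
Proof. exact: rpredM. Qed.

Lemma chiV_lin a : a \is a linear_char -> a^-1 \is a linear_char.
Proof. by rewrite rpredV. Qed.

Lemma chi1_lin : (1 : 'CF(Fx F)) \is a linear_char.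
Proof. exact: rpred1. Qed.

Lemma chev0 a : chev a 0 = 0.
Proof. by rewrite /chev insubF // unitr0. Qed.

Lemma unit_of_neq0 x : x != 0 -> {u : {unit F} | x = val u}.
Proof. by rewrite -unitfE => Ux; exists (FinRing.Unit Ux). Qed.

Lemma chev_val a (u : {unit F}) : chev a (val u) = a u.
Proof. by rewrite /chev valK. Qed.

Lemma val_unit_neq0 (u : {unit F}) : val u != 0.
Proof. by rewrite -unitfE (valP u). Qed.

Lemma chevM a b x : chev (a * b) x = chev a x * chev b x.
Proof.
have [->|/unit_of_neq0[u ->]] := eqVneq x 0; first by rewrite !chev0 mulr0.
by rewrite !chev_val cfunE.
Qed.

Lemma chev_triv x : chev 1 x = (x != 0)%:R.
Proof.
have [->|/unit_of_neq0[u ->]] := eqVneq x 0; first by rewrite chev0.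
by rewrite chev_val cfun1E inE.
Qed.

Lemma chev_inj a b : (forall x, x != 0 -> chev a x = chev b x) -> a = b.
Proof.
move=> eqab; apply/cfunP => u.
by rewrite -!chev_val eqab ?val_unit_neq0.
Qed.

Section Linear.
Variable a : 'CF(Fx F).
Hypothesis lin_a : a \is a linear_char.

Lemma chev1 : chev a 1 = 1.
Proof.
by rewrite -[1 in LHS]/(val (1%g : {unit F})) chev_val lin_char1.
Qed.

Lemma chevMr x y : chev a (x * y) = chev a x * chev a y.
Proof.
have [->|/unit_of_neq0[u ->]] := eqVneq x 0; first by rewrite mul0r !chev0 mul0r.
have [->|/unit_of_neq0[v ->]] := eqVneq y 0; first by rewrite mulr0 !chev0 mulr0.
rewrite -[val u * val v]/(val (u * v)%g) !chev_val.
by rewrite lin_charM ?inE.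
Qed.

Lemma chev_neq0 x : x != 0 -> chev a x != 0.
Proof. by move=> /unit_of_neq0[u ->]; rewrite chev_val lin_char_neq0 ?inE. Qed.

Lemma chevV x : chev a^-1 x = (chev a x)^-1.
Proof.
have [->|x0] := eqVneq x 0; first by rewrite !chev0 invr0.
apply: (mulfI (chev_neq0 x0)).
by rewrite -chevM mulrV ?lin_char_unitr // chev_triv x0 divff ?chev_neq0.
Qed.

Lemma chevVr x : chev a x^-1 = (chev a x)^-1.
Proof.
have [->|x0] := eqVneq x 0; first by rewrite invr0 chev0 invr0.
apply: (mulfI (chev_neq0 x0)).
by rewrite -chevMr !divff ?chev_neq0 // chev1.
Qed.

Lemma chevN x : chev a (- x) = chev a (-1) * chev a x.
Proof. by rewrite -[- x]mulN1r chevMr. Qed.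

Lemma chev_sign2 : chev a (-1) * chev a (-1) = 1.
Proof. by rewrite -chevMr mulrNN mulr1 chev1. Qed.

Lemma chev_signV : (chev a (-1))^-1 = chev a (-1).
Proof. by rewrite -chevVr invrN1. Qed.

End Linear.

Lemma qC_neq0 : q != 0.
Proof. by rewrite pnatr_eq0 -lt0n; apply/card_gt0P; exists 0. Qed.

Lemma card_gt1 : (1 < #|F|)%N.
Proof. exact: finNzRing_gt1. Qed.

Lemma qC_neq1 : q - 1 != 0.
Proof. by rewrite subr_eq0 pnatr_eq1 neq_ltn card_gt1 orbT. Qed.

Lemma card_unitC : #|[set: {unit F}]|%:R = q - 1.
Proof. by rewrite card_finField_unit /qC -subn1 natrB // ltnW ?card_gt1. Qed.

(** Second orthogonality for the classes of [z] and 1: the group is abelian, so the centraliser has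
    all [q - 1] elements. At [z = 0] every extended character vanishes. *)
Lemma sum_chi z : \sum_(i : Iirr (Fx F)) chev 'chi_i z = (z == 1)%:R * (q - 1).
Proof.
have [->|] := eqVneq z 0.
  by rewrite eq_sym oner_eq0 mul0r big1 // => i _; rewrite chev0.
move=> /unit_of_neq0[u ->]; under eq_bigr do rewrite chev_val.
have := @second_orthogonality_relation _ (Fx F) u 1%g (group1 _).
rewrite (eq_bigr (fun i : Iirr (Fx F) => 'chi_i u)) => [->|i _]; last first.
  by rewrite (lin_char1 (chi_lin i)) conjC1 mulr1.
rewrite class1G inE -val_eqE -card_unitC /= mulrb.
have [u1|] := eqVneq; last by rewrite mul0r.
have -> : u = 1%g by apply: val_inj.
rewrite mul1r cent11T setIT //.
Qed.

(** For [a != 1], multiplication by some [x] with [chev a x != 1] permutes the terms and scales the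
    sum by [chev a x], so the sum vanishes. *)
Lemma sum_chev a : a \is a linear_char ->
  \sum_x chev a x = (a == 1)%:R * (q - 1).
Proof.
move=> lin_a; have [->|a1] := eqVneq.
  under eq_bigr do rewrite chev_triv.
  rewrite mul1r -card_unitC card_finField_unit -(cardC1 (0 : F)) -sum1_card.
  by rewrite natr_sum [RHS]big_mkcond; apply: eq_bigr => x _; rewrite inE; case: eqP.
have [x x0 ax] : exists2 x, x != 0 & chev a x != 1.
  apply/exists_inP; apply: contraNT a1 => /exists_inPn H.
  by apply/eqP/chev_inj => x x0; rewrite chev_triv x0; apply/eqP; have := H x x0; rewrite negbK.
rewrite mul0r; apply: (mulfI (_ : chev a x - 1 != 0)); first by rewrite subr_eq0.
apply/eqP; rewrite mulr0 mulrBl mul1r subr_eq0 mulr_sumr [X in _ == X](reindex (fun y => x * y)) /=.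
  by apply/eqP/eq_bigr => y _; rewrite chevMr.
by exists (fun y => x^-1 * y) => y _; rewrite ?mulKf ?mulVKf.
Qed.

(** Multiplication by a linear character permutes the irreducible ones, with inverse the
    multiplication by [a^-1]; this is the shift of a summation character. *)
Lemma reindex_chi a (f : 'CF(Fx F) -> algC) : a \is a linear_char ->
  \sum_(i : Iirr (Fx F)) f 'chi_i = \sum_(i : Iirr (Fx F)) f (a * 'chi_i).
Proof.
move=> lin_a.
have hE b i : b \is a linear_char -> 'chi_(cfIirr (b * 'chi[Fx F]_i)) = b * 'chi_i.
  by move=> lin_b; rewrite cfIirrE // mul_lin_irr // mem_irr.
rewrite (reindex (fun i => cfIirr (a * 'chi_i))) /=.
  by apply: eq_bigr => i _; rewrite hE.
have Ua := lin_char_unitr lin_a.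
by exists (fun i => cfIirr (a^-1 * 'chi_i)) => i _; apply: irr_inj;
   rewrite !hE ?rpredV // ?mulKr ?mulVKr.
Qed.

End Characters.

Ltac lin := repeat first [ assumption | lazymatch goal with
  | |- is_true (@GRing.mul _ _ _ \is a _) => apply: chiM_lin
  | |- is_true (@GRing.inv _ _ \is a _) => apply: chiV_lin
  | |- is_true (@GRing.one _ \is a _) => apply: chi1_lin
  | |- is_true ('chi__ \is a _) => exact: chi_lin
  end ].

(* Characters are compared through their values at nonzero arguments. *)
Ltac chareq :=
  let x := fresh "x" in let x0 := fresh "x0" in
  apply: chev_inj => x x0;
  rewrite ?expr2; repeat first [ rewrite chevM | rewrite chevV; last by lin];
  rewrite ?chev_triv ?x0 ?mulr1n; field;
  repeat (apply/andP; split);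
  repeat first [ apply: mulf_neq0 | apply: chev_neq0; [by lin | exact: x0] ].

Ltac gfield := field; repeat (apply/andP; split); try assumption.

(** * Gauss and Jacobi sums: dilation, products and reflection *)

Section GaussSums.
Variables (F : finFieldType) (psi : F -> algC).
Implicit Types (a b c nu : 'CF(Fx F)) (x y z : F).
Local Notation q := (qC F).
Local Notation g := (gauss psi).
Local Notation g0 := (gauss0 psi).

Lemma chev_big0 a (f : F -> algC) : \sum_(x | x != 0) f x * chev a x = \sum_x f x * chev a x.
Proof.
rewrite [RHS](bigD1 0) //= chev0 mulr0 add0r.
by apply: eq_bigl.
Qed.

Lemma gaussE a : g a = - \sum_x psi x * chev a x.
Proof. by rewrite /gauss chev_big0. Qed.

(* Mellin inversion, applied to sums indexed by an arbitrary finite type. *)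
Lemma sum_chi_sum (T : finType) (w : T -> algC) (m : T -> F) :
  \sum_(i : Iirr (Fx F)) \sum_t w t * chev 'chi_i (m t) =
  (q - 1) * \sum_(t | m t == 1) w t.
Proof.
rewrite exchange_big /= mulr_sumr [RHS]big_mkcond; apply: eq_bigr => t _.
rewrite -mulr_sumr sum_chi; case: eqP => _; last by rewrite mul0r mulr0.
by rewrite mul1r mulrC.
Qed.

Lemma sum_dilate (f : F -> algC) y : y != 0 -> \sum_x f (y * x) = \sum_x f x.
Proof.
move=> y0; rewrite [RHS](reindex (fun x => y * x)) //=.
by exists (fun x => y^-1 * x) => x _; rewrite ?mulKf ?mulVKf.
Qed.

Lemma sum_shift (f : F -> algC) y : \sum_x f (x + y) = \sum_x f x.
Proof.
rewrite [RHS](reindex (fun x => x + y)) //=.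
by exists (fun x => x - y) => x _; rewrite ?addrK ?subrK.
Qed.

Lemma sum_opp (f : F -> algC) : \sum_x f (- x) = \sum_x f x.
Proof. by rewrite [RHS](reindex_inj oppr_inj). Qed.

(** The sign agrees with that of [gauss], so that [g a * g b = jacobi a b * g (a * b)] carries no
    sign when [a * b != 1]. *)
Definition jacobi a b : algC := - \sum_x chev a x * chev b (1 - x).

Hypothesis psiD : forall x y, psi (x + y) = psi x * psi y.
Hypothesis psi0 : psi 0 = 1.
Hypothesis psi_nontriv : exists x, psi x != 1.

Lemma sum_psi : \sum_x psi x = 0.
Proof.
have [y py] := psi_nontriv.
apply: (mulfI (_ : psi y - 1 != 0)); first by rewrite subr_eq0.
rewrite mulr0 mulrBl mul1r -[X in _ - X](sum_shift _ y) mulr_sumr -sumrB.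
by rewrite big1 // => x _; rewrite psiD mulrC subrr.
Qed.

Lemma gauss1 : g 1 = 1.
Proof.
have /eqP := sum_psi; rewrite (bigD1 0) //= psi0 addr_eq0 => /eqP ->.
by congr (- _); apply: eq_bigr => x x0; rewrite chev_triv x0 mulr1.
Qed.

Lemma gauss01 : g0 1 = q.
Proof. by rewrite /gauss0 /delta eqxx gauss1 mulr1 expr1. Qed.

Lemma gauss0_neq1 a : a != 1 -> g0 a = g a.
Proof. by move=> /negPf a1; rewrite /gauss0 /delta a1 expr0 mul1r. Qed.

(** Substitute [x / w] for [x]. The formula survives at [w = 0], where the left side is a full sum
    of a non-trivial character and [chev a^-1 0 = 0]. *)
Lemma gauss_dilate a w : a \is a linear_char -> a != 1 ->
  \sum_x psi (x * w) * chev a x = - (chev a^-1 w * g a).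
Proof.
move=> la a1; have [->|w0] := eqVneq w 0.
  under eq_bigr do rewrite mulr0 psi0 mul1r.
  by rewrite sum_chev // (negPf a1) chev0 !mul0r oppr0.
rewrite -[LHS](sum_dilate _ (invr_neq0 w0)) gaussE mulrN opprK mulr_sumr.
apply: eq_bigr => x _; rewrite mulrAC mulVf // mul1r chevMr // chevVr // chevV //.
by rewrite mulrCA.
Qed.

(** The product is grouped by [s = x + y]. Scaling by [s] gives the Jacobi sum when [s != 0]; the
    terms with [s = 0] give the correction, by orthogonality. *)
Lemma gauss_mul a b : a \is a linear_char -> b \is a linear_char ->
  g a * g b = jacobi a b * g (a * b) + (a * b == 1)%:R * chev b (-1) * (q - 1).
Proof.
move=> la lb; rewrite !gaussE mulrNN mulr_suml.
pose f s := psi s * \sum_x chev a x * chev b (s - x).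
transitivity (\sum_s f s).
  under [RHS]eq_bigr do rewrite /f mulr_sumr.
  rewrite [RHS]exchange_big; apply: eq_bigr => x _ /=; rewrite mulr_sumr.
  rewrite -[RHS](sum_shift _ x); apply: eq_bigr => y _.
  by rewrite addrK psiD; ring.
rewrite (bigD1 0) //= addrC; congr (_ + _).
  rewrite /jacobi mulrNN -chev_big0 mulr_sumr; apply: eq_bigr => s s0.
  rewrite /f -(sum_dilate _ s0) mulr_suml mulr_sumr; apply: eq_bigr => x _.
  have -> : s - s * x = s * (1 - x) by ring.
  by rewrite !chevMr // chevM; ring.
rewrite /f psi0 mul1r -mulrA mulrCA -sum_chev ?rpredM // mulr_sumr.
by apply: eq_bigr => x _; rewrite sub0r chevN // chevM; ring.
Qed.

(** The map [x / (1 - x)] is a bijection from the [x != 1] to the values other than -1, so the sum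
    is a full character sum without its term at -1. *)
Lemma jacobi_inv a : a \is a linear_char -> a != 1 -> jacobi a a^-1 = chev a (-1).
Proof.
move=> la a1; have := sum_chev la; rewrite (negPf a1) mul0r.
rewrite (bigD1 (-1)) //= => /eqP; rewrite addr_eq0 => /eqP ->; congr (- _).
rewrite (bigD1 1) //= subrr !chev0 mulr0 add0r.
rewrite (reindex_onto (fun x => x / (1 + x)) (fun x => x / (1 - x))) /=; last first.
  move=> x x1; rewrite -subr_eq0 -opprB oppr_eq0 in x1.
  by field; rewrite x1 -addrA addNr addr0 oner_neq0.
apply: eq_big => x.
  have [->|x1] := eqVneq x (-1).
    by rewrite subrr invr0 mulr0 mul0r [0 == -1]eq_sym oppr_eq0 oner_eq0 andbF.
  have x2 : 1 + x != 0 by rewrite addrC addr_eq0.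
  have E : 1 - x / (1 + x) = (1 + x)^-1 by field.
  rewrite E invrK divfK // eqxx andbT; apply/eqP.
  by move=> E1; move/eqP: E; rewrite E1 subrr eq_sym invr_eq0 (negPf x2).
case/andP=> x1 /eqP xE; have x2 : 1 + x != 0.
  apply: contraNneq (x1) => x20; move: xE; rewrite x20 invr0 mulr0 mul0r => xE.
  by move: x20; rewrite -xE addr0 => /eqP; rewrite oner_eq0.
have E : 1 - x / (1 + x) = (1 + x)^-1 by field.
by rewrite E chevV // chevVr // invrK -chevMr // divfK.
Qed.

(** Reflection formula. The power of [q] in [g0] makes it uniform: for [a = 1] it reads
    [1 * q = q]. *)
Lemma gauss_gauss0V a : a \is a linear_char -> g a * g0 a^-1 = chev a (-1) * q.
Proof.
move=> la; have [->|a1] := eqVneq a 1.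
  by rewrite invr1 gauss01 gauss1 chev_triv oppr_eq0 oner_eq0.
have Ua := lin_char_unitr la.
have a1' : a^-1 != 1 by rewrite invr_eq1.
rewrite gauss0_neq1 // gauss_mul ?rpredV // mulrV // gauss1 eqxx jacobi_inv //.
by rewrite chevV // chev_signV // mulr1n; ring.
Qed.

Lemma gauss_neq0 a : a \is a linear_char -> g a != 0.
Proof.
move=> la; have := gauss_gauss0V la; apply: contra_eq_neq => ->.
by rewrite mul0r eq_sym mulf_neq0 ?qC_neq0 ?chev_neq0 // oppr_eq0 oner_eq0.
Qed.

Lemma gauss0_neq0 a : a \is a linear_char -> g0 a != 0.
Proof. by move=> la; rewrite mulf_neq0 ?expf_neq0 ?qC_neq0 ?gauss_neq0. Qed.

Lemma gaussV a : a \is a linear_char -> g a^-1 = chev a (-1) * q / g0 a.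
Proof.
move=> la; apply: (mulIf (gauss0_neq0 la)); rewrite divfK ?gauss0_neq0 //.
have laV : a^-1 \is a linear_char by lin.
by have := gauss_gauss0V laV; rewrite invrK chevV // chev_signV.
Qed.

Lemma gauss0V a : a \is a linear_char -> g0 a^-1 = chev a (-1) * q / g a.
Proof.
by move=> la; apply: (mulfI (gauss_neq0 la)); rewrite gauss_gauss0V // [RHS]mulrC divfK ?gauss_neq0.
Qed.

(** With [g0] in the denominator the case [a * b = 1] needs no separate formula; only the pair of
    two trivial characters is excluded. *)
Lemma jacobiE a b : a \is a linear_char -> b \is a linear_char ->
  (a != 1) || (b != 1) -> jacobi a b = g a * g b / g0 (a * b).
Proof.
move=> la lb ab; have [ab1|ab1] := eqVneq (a * b) 1; last first.
  by rewrite gauss0_neq1 // gauss_mul // (negPf ab1) !mul0r addr0 mulfK ?gauss_neq0 ?rpredM.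
have Ua := lin_char_unitr la.
have bE : b = a^-1 by rewrite -[b](mulKr Ua) ab1 mulr1.
have a1 : a != 1.
  by apply: contraTneq ab; rewrite bE => ->; rewrite invr1 eqxx.
rewrite bE jacobi_inv // mulrV // gauss01 -[g a^-1]gauss0_neq1 ?invr_eq1 //.
by rewrite gauss_gauss0V // mulfK ?qC_neq0.
Qed.

(** Two reflections turn a Jacobi sum at [nu^-1] into a ratio of Gauss sums at [nu], the shape found
    in a hypergeometric summand. *)
Lemma jacobi_chiV nu c : nu \is a linear_char -> c \is a linear_char -> c != 1 ->
  jacobi nu^-1 c = chev c (-1) * g c * g (c^-1 * nu) / g0 nu.
Proof.
move=> ln lc c1; rewrite jacobiE ?rpredV ?c1 ?orbT // gaussV //.
have -> : nu^-1 * c = (c^-1 * nu)^-1 by chareq.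
have lcn : c^-1 * nu \is a linear_char by lin.
rewrite gauss0V // !(chevM, chevV) //.
field; rewrite qC_neq0 gauss_neq0 // gauss0_neq0 // !chev_neq0 ?oppr_eq0 ?oner_eq0 //.
Qed.

End GaussSums.

(** * The finite-field analogue of Gauss's evaluation of a 2F1 at 1 *)

Section GaussSummation.
Variables (F : finFieldType) (psi : F -> algC).
Implicit Types (a b c d nu : 'CF(Fx F)) (x y z : F).
Local Notation q := (qC F).
Local Notation g := (gauss psi).
Local Notation g0 := (gauss0 psi).

Lemma sum_pair_inv (w : F -> F -> algC) :
  \sum_(t : F * F | t.1 * t.2 == 1) w t.1 t.2 = \sum_(x | x != 0) w x x^-1.
Proof.
rewrite -(pair_big_dep xpredT (fun x y => x * y == 1)) /=.
rewrite (bigD1 0) //= big_pred0 => [|y]; last by rewrite mul0r eq_sym oner_eq0.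
rewrite add0r; apply: eq_bigr => x x0.
rewrite (big_pred1 x^-1) // => y /=.
by apply/eqP/eqP => [xy|->]; [rewrite -[y](mulKf x0) xy mulr1 | rewrite divff].
Qed.

(** Opening both Jacobi sums in variables [x] and [y], orthogonality keeps only the pairs with
    [x * y = 1]. *)
Lemma sum_jacobi a b c d : a \is a linear_char -> c \is a linear_char ->
  \sum_(i : Iirr (Fx F)) jacobi (a * 'chi_i) b * jacobi (c * 'chi_i) d =
  (q - 1) * \sum_(x | x != 0) chev (a * c^-1) x * chev b (1 - x) * chev d (1 - x^-1).
Proof.
move=> la lc.
pose w (x y : F) := chev a x * chev b (1 - x) * (chev c y * chev d (1 - y)).
transitivity (\sum_(i : Iirr (Fx F)) \sum_(t : F * F) w t.1 t.2 * chev 'chi_i (t.1 * t.2)).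
  apply: eq_bigr => i _; rewrite mulrNN mulr_suml.
  rewrite -(pair_big xpredT xpredT (fun x y => w x y * chev 'chi_i (x * y))) /=.
  apply: eq_bigr => x _; rewrite mulr_sumr; apply: eq_bigr => y _.
  by rewrite /w !chevM (chevMr (chi_lin i)); ring.
rewrite sum_chi_sum sum_pair_inv; congr (_ * _); apply: eq_bigr => x x0.
by rewrite /w chevM chevV // chevVr //; ring.
Qed.

Hypothesis psiD : forall x y, psi (x + y) = psi x * psi y.
Hypothesis psi0 : psi 0 = 1.
Hypothesis psi_nontriv : exists x, psi x != 1.

(** Analogue of the beta integral: a quotient of Gauss sums becomes a Jacobi sum, whose only
    dependence on [nu] is through its first character, so that orthogonality applies. *)
Lemma gauss_ratio a c nu : a \is a linear_char -> c \is a linear_char ->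
    nu \is a linear_char -> a^-1 * c != 1 ->
  g (a * nu) / g0 (c * nu) = jacobi (a * nu) (a^-1 * c) / g (a^-1 * c).
Proof.
move=> la lc ln ac; have lac : a^-1 * c \is a linear_char by lin.
have lan : a * nu \is a linear_char by lin.
rewrite (jacobiE psiD psi0 psi_nontriv) ?ac ?orbT //.
have -> : a * nu * (a^-1 * c) = c * nu by chareq.
by rewrite mulrAC mulfK // gauss_neq0.
Qed.

(** A 1F0 series at 1: orthogonality leaves only [x = 1], where the factor [chev b^-1 (1 - x)]
    vanishes. *)
Lemma sum_gauss_ratio b : b \is a linear_char -> b != 1 ->
  \sum_(i : Iirr (Fx F)) g (b * 'chi_i) / g0 'chi_i = 0.
Proof.
move=> lb b1; have b1' : b^-1 * 1 != 1 by rewrite mulr1 invr_eq1.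
transitivity (\sum_(i : Iirr (Fx F)) jacobi (b * 'chi_i) (b^-1 * 1) / g (b^-1 * 1)).
  apply: eq_bigr => i _.
  by rewrite -(gauss_ratio lb (chi1_lin F) (chi_lin i)) // mul1r.
rewrite -mulr_suml mulr1.
have -> : \sum_(i : Iirr (Fx F)) jacobi (b * 'chi_i) b^-1 =
    - \sum_(i : Iirr (Fx F)) \sum_x chev b x * chev b^-1 (1 - x) * chev 'chi_i x.
  rewrite -sumrN; apply: eq_bigr => i _; congr (- _); apply: eq_bigr => x _.
  by rewrite chevM mulrAC.
rewrite sum_chi_sum big_pred1_eq subrr chev0 mulr0 mulr0 oppr0 mul0r //.
Qed.

Lemma gauss_summation a b c : a \is a linear_char -> b \is a linear_char ->
    c \is a linear_char -> a != 1 -> b != 1 ->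
  \sum_(i : Iirr (Fx F)) g (a * 'chi_i) * g (b * 'chi_i) / (g0 'chi_i * g0 (c * 'chi_i)) =
  (1 - q) * (g a * g b * g ((a * b)^-1 * c) / (q * g0 (a^-1 * c) * g0 (b^-1 * c))).
Proof.
move=> la lb lc a1 b1; have Ua := lin_char_unitr la.
have [gaN0 gbN0] : g a != 0 /\ g b != 0 by rewrite !gauss_neq0.
have laV : a^-1 \is a linear_char by lin.
have lbV : b^-1 \is a linear_char by lin.
have sgn0 d : d \is a linear_char -> chev d (-1) != 0.
  by move=> ld; rewrite chev_neq0 // oppr_eq0 oner_eq0.
have [ac|ac] := eqVneq (a^-1 * c) 1.
  have -> : c = a by rewrite -[a]mulr1 -ac mulVKr.
  have -> : (a * b)^-1 * a = b^-1 by chareq.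
  have -> : a^-1 * a = 1 by chareq.
  rewrite gauss01 //.
  (* The quotient [g / g0] at [a * 'chi_i] is 1, except for [a * 'chi_i = 1], where it is [q^-1];
     [k] records this deviation, so only the index of [a^-1] contributes. *)
  pose k i := g (b * 'chi_i) / g0 'chi_i * (q^-1 - 1) *+ (a * 'chi[Fx F]_i == 1).
  transitivity (\sum_(i : Iirr (Fx F)) g (b * 'chi_i) / g0 'chi_i
       + \sum_i k i).
    rewrite -big_split; apply: eq_bigr => i _ /=; rewrite /k.
    have l1 : a * 'chi_i \is a linear_char by lin.
    have g1 := gauss_neq0 psiD psi0 psi_nontriv l1.
    have g2 := gauss0_neq0 psiD psi0 psi_nontriv (chi_lin i).
    have [ai|ai] := eqVneq; rewrite ?mulr1n ?mulr0n.
      rewrite ai gauss01 // gauss1 //; field.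
      by rewrite g2 qC_neq0.
    by rewrite (gauss0_neq1 _ ai); field; rewrite g1 g2.
  rewrite sum_gauss_ratio // add0r (bigD1 (cfIirr a^-1)) //= big1 => [|i ia]; last first.
    rewrite /k mulrb ifN //; apply: contra ia => /eqP ai; apply/eqP/irr_inj.
    by rewrite cfIirrE ?lin_char_irr // -[RHS]mulr1 -ai mulKr.
  rewrite /k cfIirrE ?lin_char_irr // mulrV // eqxx addr0 mulr1n.
  have lba : b^-1 * a \is a linear_char by lin.
  have -> : b * a^-1 = (b^-1 * a)^-1 by chareq.
  rewrite (gaussV psiD psi0 psi_nontriv lba) (gaussV psiD psi0 psi_nontriv lb).
  rewrite (gauss0V psiD psi0 psi_nontriv la) (gauss0_neq1 _ b1) chevM chevV //.
  have gba := gauss0_neq0 psiD psi0 psi_nontriv lba.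
  have ga0 := sgn0 _ la; have gb0 := sgn0 _ lb; have q0 := qC_neq0 F.
  rewrite chev_signV //; field.
  by rewrite ?gba ?ga0 ?gb0 ?q0 ?gaN0 ?gbN0.
have b1' : b^-1 * 1 != 1 by rewrite mulr1 invr_eq1.
have lac : a^-1 * c \is a linear_char by lin.
have lbc : b^-1 * c \is a linear_char by lin.
have labc : (a * b)^-1 * c \is a linear_char by lin.
have gac := gauss_neq0 psiD psi0 psi_nontriv lac.
have gbc := gauss0_neq0 psiD psi0 psi_nontriv lbc.
have gbV := gauss_neq0 psiD psi0 psi_nontriv lbV.
(* The Jacobi sum left over by orthogonality, up to the sign [chev (a^-1 * c) (-1)] coming from
   [1 - x^-1 = - (1 - x) / x]. *)
pose J := jacobi (b * c^-1) ((a * b)^-1 * c).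
have gJ : J = chev b (-1) * chev (a^-1 * c) (-1) * g a * g ((a * b)^-1 * c) / g0 (b^-1 * c).
  have lbc' : b * c^-1 \is a linear_char by lin.
  rewrite /J (jacobiE psiD psi0 psi_nontriv) //; last first.
    (* The product of the two characters is [a^-1], so they cannot both be trivial. *)
    rewrite -negb_and; apply: contra a1 => /andP[/eqP e1 /eqP e2].
    rewrite -invr_eq1; apply/eqP.
    by transitivity (b * c^-1 * ((a * b)^-1 * c)); [chareq|rewrite e1 e2 mulr1].
  have -> : b * c^-1 = (b^-1 * c)^-1 by chareq.
  have -> : (b^-1 * c)^-1 * ((a * b)^-1 * c) = a^-1 by chareq.
  rewrite gaussV // gauss0V // !(chevM, chevV) //.
  have ga0 := sgn0 _ la; have gb0 := sgn0 _ lb; have q0 := qC_neq0 F; have gc0 := sgn0 _ lc.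
  by rewrite (chev_signV lb); field; rewrite ?gbc ?ga0 ?gb0 ?q0 ?gaN0 ?gbN0 ?gc0.
transitivity ((g b^-1 * g (a^-1 * c))^-1 *
    \sum_(i : Iirr (Fx F)) jacobi (b * 'chi_i) b^-1 * jacobi (a * 'chi_i) (a^-1 * c)).
  rewrite mulr_sumr; apply: eq_bigr => i _.
  have lci : c * 'chi_i \is a linear_char by lin.
  have g2 := gauss0_neq0 psiD psi0 psi_nontriv (chi_lin i).
  have g1 := gauss0_neq0 psiD psi0 psi_nontriv lci.
  have := gauss_ratio la lc (chi_lin i) ac.
  have := gauss_ratio lb (chi1_lin F) (chi_lin i) b1'.
  rewrite mul1r mulr1 => e1 e2.
  transitivity ((g (b * 'chi_i) / g0 'chi_i) * (g (a * 'chi_i) / g0 (c * 'chi_i))).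
    by field; rewrite g1 g2.
  by rewrite e1 e2; field; rewrite gac gbV.
rewrite sum_jacobi //.
have -> : \sum_(x | x != 0) chev (b * a^-1) x * chev b^-1 (1 - x) * chev (a^-1 * c) (1 - x^-1)
   = - chev (a^-1 * c) (-1) * J.
  rewrite mulNr mulrN opprK mulr_sumr [RHS](bigD1 0) //= chev0 mul0r mulr0 add0r.
  apply: eq_bigr => x x0.
  have -> : 1 - x^-1 = -1 * (1 - x) / x by field.
  have -> : b * c^-1 = b * a^-1 * (a^-1 * c)^-1 by chareq.
  have -> : (a * b)^-1 * c = b^-1 * (a^-1 * c) by chareq.
  rewrite 2!(chevMr lac) (chevVr lac) (chevM _ (_^-1)) (chevV lac) (chevM _ (a^-1 * c) (1 - x)).
  ring.
rewrite gJ (gaussV psiD psi0 psi_nontriv lb) (gauss0_neq1 _ b1) (gauss0_neq1 _ ac).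
have q0 := qC_neq0 F; have gb0 := sgn0 _ lb; have gac0 := sgn0 _ lac.
have E : chev (a^-1 * c) (-1) ^+ 2 = 1 by rewrite expr2 chev_sign2.
field: E.
by rewrite ?gac ?gbc ?gbN0 ?q0 ?gb0.
Qed.

End GaussSummation.

(** * Hypergeometric and Appell functions as sums of Gauss sums; the Appell function at [y = 1] *)

Section HypergeometricSums.

Variables (F : finFieldType) (psi : F -> algC).
Implicit Types (a b c d nu : 'CF(Fx F)) (x y z : F).
Local Notation q := (qC F).
Local Notation g := (gauss psi).
Local Notation g0 := (gauss0 psi).
Hypothesis psiD : forall x y, psi (x + y) = psi x * psi y.
Hypothesis psi0 : psi 0 = 1.
Hypothesis psi_nontriv : exists x, psi x != 1.
Let gN0 := gauss_neq0 psiD psi0 psi_nontriv.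
Let g0N0 := gauss0_neq0 psiD psi0 psi_nontriv.

(** The denominators of the Pochhammer symbols do not depend on the summation character and leave
    the sum; the factor [q] is [g0 1]. *)
Lemma hypF32E a b c d e x : a \is a linear_char -> b \is a linear_char ->
    c \is a linear_char -> d \is a linear_char -> e \is a linear_char ->
  hypF psi [:: a; b; c] [:: d; e] x =
  (1 - q)^-1 * (q * g0 d * g0 e / (g a * g b * g c)) *
  \sum_(i : Iirr (Fx F)) g (a * 'chi_i) * g (b * 'chi_i) * g (c * 'chi_i) /
    (g0 'chi_i * g0 (d * 'chi_i) * g0 (e * 'chi_i)) * chev 'chi_i x.
Proof.
move=> la lb lc ld le; rewrite /hypF -mulrA; congr (_ * _).
rewrite mulr_sumr; apply: eq_bigr => i _; have li := chi_lin i.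
rewrite !big_cons !big_nil !mulr1 /poch /poch0 mul1r gauss01 //.
have q0 := qC_neq0 F; have dN0 := g0N0 ld; have eN0 := g0N0 le.
have [aN0 bN0 cN0] : [/\ g a != 0, g b != 0 & g c != 0] by split; apply: gN0.
have [iN diN eiN] : [/\ g0 'chi_i != 0, g0 (d * 'chi_i) != 0 & g0 (e * 'chi_i) != 0].
  by split; apply: g0N0; lin.
gfield.
Qed.

Lemma hypF21E a b c x : a \is a linear_char -> b \is a linear_char ->
    c \is a linear_char ->
  hypF psi [:: a; b] [:: c] x =
  (1 - q)^-1 * (q * g0 c / (g a * g b)) *
  \sum_(i : Iirr (Fx F)) g (a * 'chi_i) * g (b * 'chi_i) /
    (g0 'chi_i * g0 (c * 'chi_i)) * chev 'chi_i x.
Proof.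
move=> la lb lc; rewrite /hypF -mulrA; congr (_ * _).
rewrite mulr_sumr; apply: eq_bigr => i _; have li := chi_lin i.
rewrite !big_cons !big_nil !mulr1 /poch /poch0 mul1r gauss01 //.
have q0 := qC_neq0 F; have cN0 := g0N0 lc.
have [aN0 bN0] : g a != 0 /\ g b != 0 by split; apply: gN0.
have [iN ciN] : g0 'chi_i != 0 /\ g0 (c * 'chi_i) != 0 by split; apply: g0N0; lin.
gfield.
Qed.

(** The summand is grouped so that [g0 (c * ('chi_i * 'chi_j))] is the only factor that couples the
    two characters. *)
Lemma appellF3E a1 a2 b1 b2 c x y : a1 \is a linear_char -> a2 \is a linear_char ->
    b1 \is a linear_char -> b2 \is a linear_char -> c \is a linear_char ->
  appellF3 psi a1 a2 b1 b2 c x y =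
  ((1 - q) ^+ 2)^-1 * (q ^+ 2 * g0 c / (g a1 * g a2 * g b1 * g b2)) *
  \sum_(i : Iirr (Fx F)) \sum_(j : Iirr (Fx F))
    (g (a1 * 'chi_i) * g (b1 * 'chi_i) / g0 'chi_i * chev 'chi_i x) *
    (g (a2 * 'chi_j) * g (b2 * 'chi_j) / g0 'chi_j * chev 'chi_j y) /
    g0 (c * ('chi_i * 'chi_j)).
Proof.
move=> la1 la2 lb1 lb2 lc; rewrite /appellF3 -mulrA; congr (_ * _).
rewrite mulr_sumr; apply: eq_bigr => i _; have li := chi_lin i.
rewrite mulr_sumr; apply: eq_bigr => j _; have lj := chi_lin j.
rewrite /poch /poch0 !mul1r gauss01 //.
have q0 := qC_neq0 F; have cN0 := g0N0 lc.
have [a1N b1N] : g a1 != 0 /\ g b1 != 0 by split; apply: gN0.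
have [a2N b2N] : g a2 != 0 /\ g b2 != 0 by split; apply: gN0.
have [iN jN cijN] : [/\ g0 'chi_i != 0, g0 'chi_j != 0 & g0 (c * ('chi_i * 'chi_j)) != 0].
  by split; apply: g0N0; lin.
gfield.
Qed.

(** For a fixed first character the inner sum is [gauss_summation] with [c * 'chi_i] in place of
    [c]. *)
Lemma appellF3_at1 a1 a2 b1 b2 c x : a1 \is a linear_char -> a2 \is a linear_char ->
    b1 \is a linear_char -> b2 \is a linear_char -> c \is a linear_char ->
    a2 != 1 -> b2 != 1 ->
  appellF3 psi a1 a2 b1 b2 c x 1 =
  g0 c * g ((a2 * b2)^-1 * c) / (g0 (a2^-1 * c) * g0 (b2^-1 * c)) *
  hypF psi [:: a1; b1; (a2 * b2)^-1 * c] [:: a2^-1 * c; b2^-1 * c] x.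
Proof.
move=> la1 la2 lb1 lb2 lc a2N b2N.
have lu : a2^-1 * c \is a linear_char by lin.
have lv : b2^-1 * c \is a linear_char by lin.
have lw : (a2 * b2)^-1 * c \is a linear_char by lin.
rewrite appellF3E // hypF32E // !mulr_sumr; apply: eq_bigr => i _.
have li := chi_lin i.
have lci : c * 'chi_i \is a linear_char by lin.
have lui : a2^-1 * c * 'chi_i \is a linear_char by lin.
have lvi : b2^-1 * c * 'chi_i \is a linear_char by lin.
transitivity (((1 - q) ^+ 2)^-1 * (q ^+ 2 * g0 c / (g a1 * g a2 * g b1 * g b2)) *
  ((g (a1 * 'chi_i) * g (b1 * 'chi_i) / g0 'chi_i * chev 'chi_i x) *
   \sum_(j : Iirr (Fx F)) g (a2 * 'chi_j) * g (b2 * 'chi_j) /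
     (g0 'chi_j * g0 (c * 'chi_i * 'chi_j)))).
  congr (_ * _); rewrite mulr_sumr; apply: eq_bigr => j _.
  by rewrite chev1 ?chi_lin // mulr1 (mulrA c) -[LHS]mulrA -[X in _ * X = _]mulrA -invfM.
rewrite gauss_summation //.
have -> : (a2 * b2)^-1 * (c * 'chi_i) = (a2 * b2)^-1 * c * 'chi_i by rewrite mulrA.
have -> : a2^-1 * (c * 'chi_i) = a2^-1 * c * 'chi_i by rewrite mulrA.
have -> : b2^-1 * (c * 'chi_i) = b2^-1 * c * 'chi_i by rewrite mulrA.
have q0 := qC_neq0 F; have q1 : 1 - q != 0 by rewrite -opprB oppr_eq0 qC_neq1.
have [a1N0 b1N0] : g a1 != 0 /\ g b1 != 0 by split; apply: gN0.
have [a2N0 b2N0 wN] : [/\ g a2 != 0, g b2 != 0 & g ((a2 * b2)^-1 * c) != 0].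
  by split; apply: gN0.
have [iN uiN viN uN vN] : [/\ g0 'chi_i != 0, g0 (a2^-1 * c * 'chi_i) != 0,
    g0 (b2^-1 * c * 'chi_i) != 0, g0 (a2^-1 * c) != 0 & g0 (b2^-1 * c) != 0].
  by split; apply: g0N0.
gfield.
Qed.

End HypergeometricSums.

(** * Mellin inversion for products of Jacobi sums and of Gauss sums *)

Section Clausen.
Variables (F : finFieldType) (psi : F -> algC).
Implicit Types (a b c d e f nu : 'CF(Fx F)) (x y z : F).
Local Notation q := (qC F).
Local Notation g := (gauss psi).
Local Notation g0 := (gauss0 psi).

(** Orthogonality selects [u = z]. Since [z / 0 = 0], the term [u = 0] never contributes, and
    nothing remains when [z = 0]. *)
Lemma sum_chi_pick (k : F -> algC) z :
  \sum_(i : Iirr (Fx F)) \sum_u k u * chev 'chi_i (z / u) = (z != 0)%:R * ((q - 1) * k z).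
Proof.
rewrite sum_chi_sum; have [->|z0] := eqVneq z 0.
  by rewrite big_pred0 ?mulr0 ?mul0r // => u; rewrite mul0r eq_sym oner_eq0.
rewrite mul1r (big_pred1 z) // => u /=.
have [->|u0] := eqVneq u 0; first by rewrite invr0 mulr0 !(eq_sym 0) oner_eq0 (negPf z0).
by rewrite -(inj_eq (mulIf u0)) divfK // mul1r eq_sym.
Qed.

(** Links a character sum to the Euler integral of a 2F1: the variable [u] of the first Jacobi sum
    is forced to be [z * v]. *)
Lemma sum_jacobi2 d e a z : d \is a linear_char -> e \is a linear_char -> z != 0 ->
  \sum_(i : Iirr (Fx F)) jacobi ('chi_i)^-1 d * jacobi (e * 'chi_i) a * chev 'chi_i z =
  (q - 1) * \sum_v chev e v * chev a (1 - v) * chev d (1 - z * v).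
Proof.
move=> ld le z0.
transitivity (\sum_(i : Iirr (Fx F)) \sum_v (chev e v * chev a (1 - v) *
    \sum_u chev d (1 - u) * chev 'chi_i (z * v / u))).
  apply: eq_bigr => i _; have li := chi_lin i.
  rewrite mulrNN mulrAC mulr_sumr; apply: eq_bigr => v _.
  rewrite !mulr_suml mulr_sumr; apply: eq_bigr => u _.
  by rewrite chevM !(chevMr li) (chevVr li) (chevV li); ring.
rewrite exchange_big mulr_sumr; apply: eq_bigr => v _ /=.
rewrite -mulr_sumr (sum_chi_pick (fun u => chev d (1 - u))).
have [->|v0] := eqVneq v 0; first by rewrite chev0 !mul0r mulr0.
by rewrite mulf_neq0 // mul1r; ring.
Qed.

(** The analogous double integral for a 3F2: the third Jacobi sum is opened in [s], which replaces
    [z] by [z / s] in [sum_jacobi2], and then [v = s * w]. *)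
Lemma sum_jacobi3 d e a f b z : d \is a linear_char -> e \is a linear_char ->
  f \is a linear_char -> z != 0 ->
  \sum_(i : Iirr (Fx F)) jacobi ('chi_i)^-1 d * jacobi (e * 'chi_i) a *
     jacobi (f * ('chi_i)^-1) b * chev 'chi_i z =
  (1 - q) * \sum_(s | s != 0) \sum_w chev f s * chev b (1 - s) *
    (chev e (s * w) * chev a (1 - s * w)) * chev d (1 - z * w).
Proof.
move=> ld le lf z0.
transitivity (- \sum_(i : Iirr (Fx F)) \sum_(s | s != 0) (chev f s * chev b (1 - s) *
  (jacobi ('chi_i)^-1 d * jacobi (e * 'chi_i) a * chev 'chi_i (z / s)))).
  rewrite -sumrN; apply: eq_bigr => i _; have li := chi_lin i.
  rewrite mulrN mulNr; congr (- _); rewrite mulr_sumr mulr_suml.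
  rewrite (bigD1 0) //= chev0 mul0r mulr0 mul0r add0r; apply: eq_bigr => s s0.
  by rewrite chevM (chevMr li) (chevVr li) (chevV li); ring.
rewrite -opprB mulNr exchange_big mulr_sumr; congr (- _); apply: eq_bigr => s s0 /=.
rewrite -mulr_sumr sum_jacobi2 ?mulf_neq0 ?invr_neq0 // mulrCA; congr (_ * _).
rewrite -(sum_dilate _ s0) mulr_sumr; apply: eq_bigr => w _.
have -> : z / s * (s * w) = z * w by field.
by ring.
Qed.

Hypothesis psiD : forall x y, psi (x + y) = psi x * psi y.
Hypothesis psi0 : psi 0 = 1.
Hypothesis psi_nontriv : exists x, psi x != 1.
Let gN0 := gauss_neq0 psiD psi0 psi_nontriv.
Let g0N0 := gauss0_neq0 psiD psi0 psi_nontriv.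

(** A 2F0 series as a confluent sum: [g (b * 'chi_i) / g0 'chi_i] is a Jacobi sum in [x],
    [g (a * 'chi_i)] is opened in [t], and orthogonality forces [t * x * z = 1]. *)
Lemma sum_gauss2 a b z : a \is a linear_char -> b \is a linear_char -> b != 1 -> z != 0 ->
  \sum_(i : Iirr (Fx F)) g (a * 'chi_i) * g (b * 'chi_i) / g0 'chi_i * chev 'chi_i z =
  (q - 1) / g b^-1 * \sum_r psi (r / z) * chev a (r / z) * chev b^-1 (r - 1).
Proof.
move=> la lb b1 z0.
have b1' : b^-1 * 1 != 1 by rewrite mulr1 invr_eq1.
have lbV : b^-1 \is a linear_char by lin.
have gbV := gN0 lbV.
transitivity ((g b^-1)^-1 * \sum_(i : Iirr (Fx F)) \sum_x (chev b x * chev b^-1 (1 - x) *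
    \sum_t psi t * chev a t * chev 'chi_i (t * (x * z)))).
  rewrite mulr_sumr; apply: eq_bigr => i _; have li := chi_lin i.
  have := gauss_ratio psiD psi0 psi_nontriv lb (chi1_lin F) li b1'.
  rewrite mul1r mulr1 => E; rewrite -[X in X * _ = _]mulrA E.
  transitivity ((g b^-1)^-1 * (jacobi (b * 'chi_i) b^-1 * (g (a * 'chi_i) * chev 'chi_i z))).
    by field.
  congr (_ * _); rewrite gaussE /jacobi !mulNr mulrN opprK mulr_suml; apply: eq_bigr => x _.
  rewrite !mulr_suml !mulr_sumr; apply: eq_bigr => t _.
  by rewrite !chevM !(chevMr li); ring.
rewrite exchange_big -mulrA mulrCA; congr (_ * _).
transitivity (\sum_(x | x != 0) chev b x * chev b^-1 (1 - x) * 
    ((q - 1) * (psi (x * z)^-1 * chev a (x * z)^-1))).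
  rewrite (bigD1 0) //= big1 => [|i _]; last by rewrite chev0 !mul0r.
  rewrite add0r; apply: eq_bigr => x x0; rewrite -mulr_sumr; congr (_ * _).
  rewrite sum_chi_sum (big_pred1 (x * z)^-1) // => t /=.
  have xz0 := mulf_neq0 x0 z0.
  by apply/eqP/eqP => [E|->]; [rewrite -[t](mulfK xz0) E mul1r | rewrite mulVf].
(* The variable of the confluent sum is [r = x^-1]; its term [r = 0] vanishes because of
   [chev a]. *)
rewrite (reindex_inj invr_inj) /= mulr_sumr.
rewrite [RHS](bigD1 0) //= mul0r chev0 mulr0 mul0r mulr0 add0r.
apply: eq_big => [x|x]; first by rewrite invr_eq0.
rewrite invr_eq0 => x0; have -> : (x^-1 * z)^-1 = x / z by gfield.
have -> : 1 - x^-1 = (x - 1) / x by field.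
rewrite (chevMr lbV) (chevVr lbV) (chevVr lb) !(chevV lb).
have bx := chev_neq0 lb x0; have [->|x1] := eqVneq x 1.
  by rewrite subrr !chev0 ?invr0 !(mulr0, mul0r, invr0).
have x2 : x - 1 != 0 by rewrite subr_eq0.
have bx1 := chev_neq0 lb x2; gfield.
Qed.
End Clausen.

(** * Integral representations of the Appell function, and its reduction to a 3F2 *)

Section AppellIntegral.
Variables (F : finFieldType) (psi : F -> algC).
Implicit Types (a b c d e f nu : 'CF(Fx F)) (x y z : F).
Local Notation q := (qC F).
Local Notation g := (gauss psi).
Local Notation g0 := (gauss0 psi).
Hypothesis psiD : forall x y, psi (x + y) = psi x * psi y.
Hypothesis psi0 : psi 0 = 1.
Hypothesis psi_nontriv : exists x, psi x != 1.
Let gN0 := gauss_neq0 psiD psi0 psi_nontriv.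
Let g0N0 := gauss0_neq0 psiD psi0 psi_nontriv.

(** By reflection the reciprocal is a Gauss sum of [c^-1]. Each of its terms is multiplicative in
    [c], which lets the two summation characters of the Appell function separate. *)
Lemma gauss0_inv c : c \is a linear_char ->
  (g0 c)^-1 = - q^-1 * \sum_t psi (- t) * chev c^-1 t.
Proof.
move=> lc; have lcV : c^-1 \is a linear_char by lin.
have [gc gcV] := (g0N0 lc, gN0 lcV).
have q0 := qC_neq0 F.
have sc : chev c (-1) != 0 by rewrite chev_neq0 // oppr_eq0 oner_eq0.
have -> : \sum_t psi (- t) * chev c^-1 t = - chev c^-1 (-1) * g c^-1.
  rewrite gaussE mulNr mulrN opprK mulr_sumr -[LHS]sum_opp.
  by apply: eq_bigr => t _; rewrite opprK (chevN lcV); ring.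
have := gaussV psiD psi0 psi_nontriv lc => ->.
by rewrite (chevV lc); gfield.
Qed.

(** After [gauss0_inv] the sums over the two characters are independent, and each is [sum_gauss2],
    at [x / t] and at [y / t]. *)
Lemma appellF3_integral a1 a2 b1 b2 c x y : a1 \is a linear_char -> a2 \is a linear_char ->
    b1 \is a linear_char -> b2 \is a linear_char -> c \is a linear_char ->
    b1 != 1 -> b2 != 1 -> x != 0 -> y != 0 ->
  appellF3 psi a1 a2 b1 b2 c x y =
  - (q * g0 c / (g a1 * g a2 * g b1 * g b2 * g b1^-1 * g b2^-1)) *
  \sum_t psi (- t) * chev c^-1 t *
    ((\sum_r psi (t * r / x) * chev a1 (t * r / x) * chev b1^-1 (r - 1)) *
     (\sum_r psi (t * r / y) * chev a2 (t * r / y) * chev b2^-1 (r - 1))).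
Proof.
move=> la1 la2 lb1 lb2 lc b1N b2N x0 y0; have lcV : c^-1 \is a linear_char by lin.
rewrite appellF3E //.
pose H a b z := \sum_(i : Iirr (Fx F)) g (a * 'chi_i) * g (b * 'chi_i) / g0 'chi_i * chev 'chi_i z.
transitivity (((1 - q) ^+ 2)^-1 * (q ^+ 2 * g0 c / (g a1 * g a2 * g b1 * g b2)) *
   (- q^-1 * \sum_(t | t != 0) psi (- t) * chev c^-1 t * (H a1 b1 (x / t) * H a2 b2 (y / t)))).
  congr (_ * _); rewrite mulr_sumr /H.
  under [RHS]eq_bigr do rewrite mulr_suml 2!mulr_sumr.
  rewrite [RHS]exchange_big; apply: eq_bigr => i _ /=; have li := chi_lin i.
  under [RHS]eq_bigr do rewrite 3!mulr_sumr.
  rewrite [RHS]exchange_big; apply: eq_bigr => j _ /=; have lj := chi_lin j.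
  have lcij : c * ('chi_i * 'chi_j) \is a linear_char by lin.
  rewrite (gauss0_inv lcij) 2!mulr_sumr.
  (* The term [t = 0] is zero; dropping it keeps [x / t] and [y / t] nonzero, as [sum_gauss2]
     requires. *)
  rewrite (bigD1 0) //= chev0 !mulr0 add0r; apply: eq_bigr => t t0.
  rewrite (chevV lcij) (chevV lc) !chevM !(chevMr li) !(chevMr lj) (chevVr li) (chevVr lj).
  move: (g _ * g _ / g0 _) (g _ * g _ / g0 _) => u v; have q0 := qC_neq0 F.
  by have [ct it jt] := And3 (chev_neq0 lc t0) (chev_neq0 li t0) (chev_neq0 lj t0); gfield.
have gb1 : g b1^-1 != 0 by apply: gN0; lin.
have gb2 : g b2^-1 != 0 by apply: gN0; lin.
transitivity (((1 - q) ^+ 2)^-1 * (q ^+ 2 * g0 c / (g a1 * g a2 * g b1 * g b2)) *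
   (- q^-1 * (((q - 1) / g b1^-1) * ((q - 1) / g b2^-1) *
    \sum_(t | t != 0) psi (- t) * chev c^-1 t *
    ((\sum_r psi (t * r / x) * chev a1 (t * r / x) * chev b1^-1 (r - 1)) *
     (\sum_r psi (t * r / y) * chev a2 (t * r / y) * chev b2^-1 (r - 1)))))).
  congr (_ * (_ * _)); rewrite mulr_sumr; apply: eq_bigr => t t0.
  rewrite /H !sum_gauss2 ?mulf_neq0 ?invr_neq0 //.
  have E r z : z != 0 -> r / (z / t) = t * r / z by move=> z0; gfield.
  under eq_bigr do rewrite E //.
  rewrite [X in _ * (_ * (_ * X)) = _](eq_bigr
    (fun r => psi (t * r / y) * chev a2 (t * r / y) * chev b2^-1 (r - 1))) => [|r _]; last by rewrite E.
  by move: (\sum_r _) (\sum_r _) (_ / _) (_ / _) => u1 u2 u3 u4; ring.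
rewrite [in RHS](bigD1 0) //= chev0 mulr0 mul0r add0r.
have q0 := qC_neq0 F; have q1 : 1 - q != 0 by rewrite -opprB oppr_eq0 qC_neq1.
have [a1N0 b1N0] : g a1 != 0 /\ g b1 != 0 by split; apply: gN0.
have [a2N0 b2N0] : g a2 != 0 /\ g b2 != 0 by split; apply: gN0.
by move: (\sum_(t | _) _) => u; gfield.
Qed.

(** The powers of [t] combine to [chev d t], and the sum over [t] is a dilated Gauss sum with
    dilation factor [r / x + s / y - 1]. *)
Lemma appellF3_double a1 a2 b1 b2 c d x y : a1 \is a linear_char -> a2 \is a linear_char ->
    b1 \is a linear_char -> b2 \is a linear_char -> c \is a linear_char ->
    d = a1 * a2 * c^-1 -> d != 1 ->
    b1 != 1 -> b2 != 1 -> x != 0 -> y != 0 ->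
  appellF3 psi a1 a2 b1 b2 c x y =
  q * g0 c * g d / (g a1 * g a2 * g b1 * g b2 * g b1^-1 * g b2^-1) *
  \sum_r \sum_s chev a1 (r / x) * chev b1^-1 (r - 1) * chev a2 (s / y) * chev b2^-1 (s - 1) *
    chev d^-1 (r / x + s / y - 1).
Proof.
move=> la1 la2 lb1 lb2 lc dE d1 b1N b2N x0 y0.
have ld : d \is a linear_char by rewrite dE; lin.
rewrite appellF3_integral // mulNr -mulrN.
transitivity (q * g0 c / (g a1 * g a2 * g b1 * g b2 * g b1^-1 * g b2^-1) *
  (g d * \sum_r \sum_s chev a1 (r / x) * chev b1^-1 (r - 1) * chev a2 (s / y) * chev b2^-1 (s - 1) *
    chev d^-1 (r / x + s / y - 1))); last by move: (_^-1) => u; ring.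
congr (_ * _).
under eq_bigr do rewrite mulr_suml mulr_sumr.
rewrite exchange_big -sumrN mulr_sumr; apply: eq_bigr => r _ /=.
under eq_bigr do rewrite 2!mulr_sumr.
rewrite exchange_big -sumrN mulr_sumr; apply: eq_bigr => s _ /=.
transitivity (- (chev a1 (r / x) * chev b1^-1 (r - 1) * chev a2 (s / y) * chev b2^-1 (s - 1)) *
   \sum_t psi (t * (r / x + s / y - 1)) * chev d t); last first.
  by rewrite gauss_dilate //; ring.
rewrite mulNr mulr_sumr; congr (- _); apply: eq_bigr => t _.
have -> : t * (r / x + s / y - 1) = - t + t * r / x + t * s / y by ring.
rewrite !psiD dE !chevM -!(mulrA t) !(chevMr la1) !(chevMr la2); ring.
Qed.

(** Here [1 / x + 1 / y = 1], so centring both variables at 1 removes the constant from the linear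
    form in [appellF3_double]; what remains is the double sum of [sum_jacobi3]. *)
Lemma appellF3_clausen a1 a2 b1 b2 c z : a1 \is a linear_char -> a2 \is a linear_char ->
    b1 \is a linear_char -> b2 \is a linear_char -> c \is a linear_char ->
    a1 != 1 -> a2 != 1 -> b1 != 1 -> b2 != 1 -> (a1 * a2)^-1 * c != 1 -> z != 1 ->
  appellF3 psi a1 a2 b1 b2 c z (z / (z - 1)) =
  g (a1 * a2 * c^-1) * g (a2 * b1 * c^-1) * g b2^-1
   / (g c^-1 * g0 (a1 * a2 * b1 * c^-1) * g0 (a2 * b2^-1))
   * chev c^-1 z * chev a2 (1 - z)
   * hypF psi [:: a1 * a2 * c^-1; a2 * b1 * c^-1; b2^-1]
              [:: a1 * a2 * b1 * c^-1; a2 * b2^-1] (1 - z).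
Proof.
move=> la1 la2 lb1 lb2 lc a1N a2N b1N b2N cN z1.
(* At [z = 0] both sides are zero, the right one through [chev c^-1 z]. *)
have [->|z0] := eqVneq z 0.
  rewrite chev0 mulr0 !mul0r /appellF3 big1 ?mulr0 // => i _.
  by rewrite big1 // => j _; rewrite chev0 mulr0 mul0r.
have z2 : z - 1 != 0 by rewrite subr_eq0.
have z3 : 1 - z != 0 by rewrite -opprB oppr_eq0.
pose d := a1 * a2 * c^-1.
have dE : d^-1 = (a1 * a2)^-1 * c by rewrite /d; chareq.
have d1 : d != 1 by rewrite -invr_eq1 dE.
have ld : d \is a linear_char by rewrite /d; lin.
have ldV : d^-1 \is a linear_char by lin.
have lb1V : b1^-1 \is a linear_char by lin.
have lb2V : b2^-1 \is a linear_char by lin.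
have lcV : c^-1 \is a linear_char by lin.
have lf : b1^-1 * d^-1 \is a linear_char by lin.
rewrite (@appellF3_double _ _ _ _ _ d) ?mulf_neq0 ?invr_neq0 //.
set S := \sum_r _.
have Sj : (1 - q) *
    (chev b1 (-1) * chev b2 (-1) * chev d (-1) * chev d^-1 z * chev a1 z * chev a2 (z / (z - 1)) * S) =
  \sum_(i : Iirr (Fx F)) jacobi ('chi_i)^-1 d^-1 * jacobi (b2^-1 * 'chi_i) a2 *
     jacobi (b1^-1 * d^-1 * ('chi_i)^-1) a1 * chev 'chi_i (1 - z).
  rewrite sum_jacobi3 //; congr (_ * _).
  (* The two variables become [1 + s] and [1 + s * w]; [s = 0] drops out because of [chev b1^-1]. A
     change of sign of [s] then gives the factors [1 - s] and [1 - s * w]. *)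
  rewrite /S -(sum_shift _ 1) (bigD1 0) //= big1 => [|s _]; last first.
    by rewrite add0r subrr chev0 mulr0 !mul0r.
  rewrite add0r mulr_sumr [RHS](reindex_inj oppr_inj) /=.
  apply: eq_big => [s|s s0]; first by rewrite oppr_eq0.
  rewrite -(sum_shift _ 1) -(sum_dilate _ s0) mulr_sumr; apply: eq_bigr => w _ /=.
  have -> : (s + 1) / z + (s * w + 1) / (z / (z - 1)) - 1 = s * (1 - (1 - z) * w) / z.
    by gfield.
  rewrite !addrK !opprK mulNr opprK (chevN lf) (chevN lb2V).
  rewrite ![1 + _]addrC 2!(chevMr ldV) (chevVr ldV) (chevMr la1 (s + 1)) (chevMr la2 (s * w + 1)).
  rewrite (chevVr la1) (chevVr la2) 2!(chevM b1^-1).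
  rewrite (chevV lb1 (-1)) (chevV lb2 (-1)) (chevV ld (-1)) !chev_signV //.
  have n1 := chev_neq0 ldV z0; have n2 := chev_neq0 la1 z0.
  have n3 : chev a2 (z / (z - 1)) != 0 by rewrite chev_neq0 // mulf_neq0 ?invr_neq0.
  by gfield.
have lb1d : b1 * d \is a linear_char by lin.
have lu : a2 * b1 * c^-1 \is a linear_char by lin.
have lv : a2 * b2^-1 \is a linear_char by lin.
(* The first and third Jacobi sums carry an inverse character and go through [jacobi_chiV], the
   second through [jacobiE]; together they form the 3F2 summand. *)
have Sg : \sum_(i : Iirr (Fx F)) jacobi ('chi_i)^-1 d^-1 * jacobi (b2^-1 * 'chi_i) a2 *
     jacobi (b1^-1 * d^-1 * ('chi_i)^-1) a1 * chev 'chi_i (1 - z) =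
   chev d^-1 (-1) * chev a1 (-1) * g d^-1 * g a1 * g a2 *
  \sum_(i : Iirr (Fx F)) g (d * 'chi_i) * g (a2 * b1 * c^-1 * 'chi_i) * g (b2^-1 * 'chi_i) /
    (g0 'chi_i * g0 (a1 * a2 * b1 * c^-1 * 'chi_i) * g0 (a2 * b2^-1 * 'chi_i)) * chev 'chi_i (1 - z).
  rewrite mulr_sumr; apply: eq_bigr => i _; have li := chi_lin i.
  have lb1di : b1 * d * 'chi_i \is a linear_char by lin.
  have lb2i : b2^-1 * 'chi_i \is a linear_char by lin.
  have -> : b1^-1 * d^-1 * ('chi_i)^-1 = (b1 * d * 'chi_i)^-1 by chareq.
  rewrite !(jacobi_chiV psiD psi0 psi_nontriv) // ?invr_eq1 //.
  rewrite (jacobiE psiD psi0 psi_nontriv lb2i la2) ?a2N ?orbT //.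
  have -> : d^-1^-1 * 'chi_i = d * 'chi_i by chareq.
  have -> : a1^-1 * (b1 * d * 'chi_i) = a2 * b1 * c^-1 * 'chi_i by rewrite /d; chareq.
  have -> : b1 * d * 'chi_i = a1 * a2 * b1 * c^-1 * 'chi_i by rewrite /d; chareq.
  have -> : b2^-1 * 'chi_i * a2 = a2 * b2^-1 * 'chi_i by chareq.
  have m1 : g0 'chi_i != 0 by apply: g0N0.
  have m2 : g0 (a1 * a2 * b1 * c^-1 * 'chi_i) != 0 by apply: g0N0; lin.
  have m3 : g0 (a2 * b2^-1 * 'chi_i) != 0 by apply: g0N0; lin.
  by gfield.
have lw : a1 * a2 * b1 * c^-1 \is a linear_char by lin.
rewrite hypF32E // -/d; rewrite {}Sg in Sj; move: Sj; set T := \sum_(i : Iirr _) _ => Sj.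
have q0 := qC_neq0 F; have q1 : 1 - q != 0 by rewrite -opprB oppr_eq0 qC_neq1.
have sgn e : e \is a linear_char -> chev e (-1) ^+ 2 = 1.
  by move=> le; rewrite expr2 chev_sign2.
have sgn0 e : e \is a linear_char -> chev e (-1) != 0.
  by move=> le; rewrite chev_neq0 // oppr_eq0 oner_eq0.
pose K := chev b1 (-1) * chev b2 (-1) * chev d (-1) * chev d^-1 z * chev a1 z * chev a2 (z / (z - 1)).
have K0 : K != 0.
  by rewrite /K !mulf_neq0 ?sgn0 ?chev_neq0 // ?mulf_neq0 ?invr_neq0.
have -> : S = chev d^-1 (-1) * chev a1 (-1) * g d^-1 * g a1 * g a2 * T / ((1 - q) * K).
  apply: (mulIf (mulf_neq0 q1 K0)); rewrite [RHS](divfK (mulf_neq0 q1 K0)).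
  by rewrite -[RHS]Sj /K; ring.
have Ed x : chev d x = chev a1 x * chev a2 x * (chev c x)^-1.
  by rewrite /d !chevM (chevV lc).
have E2 : chev a2 (z / (z - 1)) = chev a2 z / (chev a2 (-1) * chev a2 (1 - z)).
  by rewrite (chevMr la2) (chevVr la2) -opprB (chevN la2).
rewrite /K !(chevV ld) !Ed E2 (chevV lc).
rewrite (gaussV psiD psi0 psi_nontriv ld) (gaussV psiD psi0 psi_nontriv lc).
rewrite (gaussV psiD psi0 psi_nontriv lb1) (gaussV psiD psi0 psi_nontriv lb2).
rewrite (gauss0_neq1 _ d1) (gauss0_neq1 _ b1N) (gauss0_neq1 _ b2N) -/d Ed.
have [s1 s2 s3 s4 s5] := And5 (sgn _ la1) (sgn _ la2) (sgn _ lb1) (sgn _ lb2) (sgn _ lc).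
have [t1 t2 t3 t4 t5] := And5 (sgn0 _ la1) (sgn0 _ la2) (sgn0 _ lb1) (sgn0 _ lb2) (sgn0 _ lc).
have [u1 u2 u3 u4 u5] := And5 (gN0 la1) (gN0 la2) (gN0 lb1) (gN0 lb2) (gN0 ld).
have [v1 v2 v3 v4] := And4 (g0N0 lc) (g0N0 lw) (g0N0 lv) (gN0 lu).
have [w1 w2 w3 w4] := And4 (chev_neq0 la1 z0) (chev_neq0 la2 z0) (chev_neq0 lc z0) (chev_neq0 la2 z3).
(* Values at -1 become variables whose squares are 1, so that [field] can reduce the signs. *)
move: s1 s2 s3 s4 s5 t1 t2 t3 t4 t5.
move: (chev a1 (-1)) (chev a2 (-1)) (chev b1 (-1)) (chev b2 (-1)) (chev c (-1)).
move=> e1 e2 e3 e4 e5 s1 s2 s3 s4 s5 t1 t2 t3 t4 t5.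
field: s1 s2 s3 s4 s5.
by repeat (apply/andP; split).
Qed.

End AppellIntegral.

(** * The quadratic character in odd characteristic *)

Section QuadraticCharacter.
Variable F : finFieldType.
Implicit Types (x y z : F) (f : F -> algC).
Hypothesis odd_char : ~~ (2%N \in [pchar F]).
Local Notation phi := (quad_char F).

Lemma two_neq0 : 2%:R != 0 :> F.
Proof. by apply: contra odd_char => two0; rewrite inE /= two0. Qed.

Lemma oppr_neq x : x != 0 -> - x != x.
Proof.
by move=> x0; rewrite -subr_eq0 -opprD oppr_eq0 -mulr2n -mulr_natl mulf_neq0 ?two_neq0.
Qed.

Lemma even_card_Fx : (2 %| #|Fx F|)%N.
Proof.
have U : (-1 : F) \is a GRing.unit by rewrite unitrN1.
pose u := FinRing.Unit U.
have <- : #[u]%g = 2%N.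
  apply: nt_prime_order => //; first by apply: val_inj; rewrite /= mulrNN mulr1.
  by rewrite -val_eqE /= oppr_neq ?oner_neq0.
by rewrite order_dvdG ?inE.
Qed.

(** The linear characters form a group of order the index of the derived subgroup, here the even
    number [#|Fx F|]; Cauchy's theorem gives an element of order 2. *)
Lemma exists_order2_char : exists2 chi : 'CF(Fx F), chi \is a linear_char &
  chi * chi = 1 /\ chi != 1.
Proof.
have [linG [cF [inj_cF cardG lin_cF _] [cF1 cFM _ _ _]]] := lin_char_group (Fx F).
have der1 : ((Fx F)^`(1))%g = 1%g.
  exact/derG1P/cyclic_abelian/field_unit_group_cyclic.
have := even_card_Fx; rewrite -(indexg1 (Fx F)) -der1 -cardG -cardsT.
case/(Cauchy (isT : prime 2)) => u _ ord_u; exists (cF u) => //; split.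
  by rewrite -cFM -cF1; congr (cF _); rewrite -[(u * u)%g]/(u ^+ 2)%g -ord_u expg_order.
apply/eqP; rewrite -cF1 => /inj_cF u1.
by rewrite u1 order1 in ord_u.
Qed.

(** Ensures that the [pick] in [quad_char] succeeds. A character of order 2 sends a generator [t] to
    -1, hence [t ^+ k] to [(-1) ^+ k], and [t ^+ k] is a square exactly for even [k]. *)
Lemma exists_quad_char : exists i : Iirr (Fx F), [forall u : {unit F},
  'chi_i u == (if [exists y : F, y ^+ 2 == val u] then 1 else -1)].
Proof.
have [chi lin_chi [chi2 chi1]] := exists_order2_char.
exists (cfIirr chi); rewrite cfIirrE ?lin_char_irr //.
have /cyclicP[t defFx] : cyclic (Fx F) by exact: field_unit_group_cyclic.
have chi_t : chi t = -1.
  have : chi t * chi t = 1.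
    by have /cfunP/(_ t) := chi2; rewrite cfunE cfun1E inE.
  move/eqP; rewrite -expr2 sqrf_eq1 => /orP[/eqP chit|/eqP//].
  case/eqP: chi1; apply/cfunP => u; have : u \in <[t]>%g by rewrite -defFx inE.
  case/cycleP=> k ->.
  by rewrite lin_charX ?inE // chit expr1n cfun1E inE.
apply/forallP => u; have : u \in <[t]>%g by rewrite -defFx inE.
case/cycleP=> k ->; rewrite lin_charX ?inE // chi_t.
rewrite -signr_odd; case: ifP => [/existsP[y /eqP y2]|].
  have Uy : y \is a GRing.unit.
    by rewrite unitfE; apply: contraTneq (val_unit_neq0 (t ^+ k)) => y0; rewrite -y2 y0 expr0n eqxx.
  pose v := FinRing.Unit Uy.
  have vE : (t ^+ k = v ^+ 2)%g by apply: val_inj; rewrite /= -y2.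
  have : chi (t ^+ k)%g = 1.
    have /cfunP/(_ v) := chi2; rewrite cfunE cfun1E inE => v2.
    by rewrite vE (_ : (v ^+ 2)%g = (v * v)%g) // lin_charM ?inE.
  by rewrite lin_charX ?inE // chi_t => E; rewrite signr_odd E.
case: (boolP (odd k)) => // ev /existsP[]; exists (val (t ^+ k./2)%g).
by rewrite -[_ ^+ 2]/(val ((t ^+ k./2) ^+ 2)%g) -expgM muln2 even_halfK.
Qed.

Lemma quad_char_lin : phi \is a linear_char.
Proof.
rewrite /quad_char; case: pickP => [i _|none]; first exact: chi_lin.
by have [i] := exists_quad_char; rewrite none.
Qed.

Lemma chev_quad x : x != 0 -> chev phi x = if [exists y, y ^+ 2 == x] then 1 else -1.
Proof.
move=> /unit_of_neq0[u ->]; rewrite chev_val /quad_char.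
case: pickP => [i /forallP/(_ u)/eqP//|none].
by have [i] := exists_quad_char; rewrite none.
Qed.

Lemma quad_char_sqr : phi * phi = 1.
Proof.
apply: chev_inj => x x0; rewrite chevM chev_quad // chev_triv x0.
by case: ifP; rewrite ?mulrNN mulr1.
Qed.

Lemma quad_charV : phi^-1 = phi.
Proof.
by rewrite -[RHS](mulKr (lin_char_unitr quad_char_lin)) quad_char_sqr mulr1.
Qed.

(** [1 + chev phi y] counts the square roots of [y], including the single root of 0. *)
Lemma sum_square f : \sum_x f (x ^+ 2) = \sum_y (1 + chev phi y) * f y.
Proof.
rewrite (partition_big (fun x => x ^+ 2) xpredT) //=; apply: eq_bigr => y _.
have [->|y0] := eqVneq y 0.
  rewrite chev0 addr0 mul1r (big_pred1 0) ?expr0n // => x /=.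
  by rewrite expf_eq0.
rewrite chev_quad //; case: ifP => [/existsP[z /eqP z2]|/negbT/existsPn nosq].
  have z0 : z != 0 by apply: contraNneq y0 => z0; rewrite -z2 z0 expr0n.
  rewrite (bigD1 z) ?z2 //= (big_pred1 (- z)) => [|x /=]; last first.
    rewrite -z2 eqf_sqr; have [->|] := eqVneq x z; rewrite /= ?andbF ?andbT //.
    by rewrite eq_sym (negPf (oppr_neq z0)).
  by rewrite sqrrN z2 mulrDl mul1r.
by rewrite subrr mul0r big_pred0 // => x; apply/negbTE/nosq.
Qed.

(** Counting all [x] with [sum_square] shows that the values of [phi] sum to zero, whereas those of
    the trivial character sum to [q - 1]. *)
Lemma quad_char_neq1 : phi != 1.
Proof.
apply/eqP => phi1; have := sum_square (fun=> 1).
under [X in _ = X]eq_bigr do rewrite mulr1; rewrite big_split /= phi1.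
rewrite -[LHS]addr0 => /addrI/esym/eqP.
by rewrite sum_chev ?chi1_lin // eqxx mul1r (negPf (qC_neq1 F)).
Qed.

End QuadraticCharacter.

(** * Bessel-type sums as twisted Kloosterman sums *)

Section BesselKloosterman.
Variables (F : finFieldType) (psi : F -> algC).
Implicit Types (a b c d e f nu : 'CF(Fx F)) (x y z : F).
Local Notation q := (qC F).
Local Notation g := (gauss psi).
Local Notation g0 := (gauss0 psi).
Local Notation phi := (quad_char F).
Hypothesis psiD : forall x y, psi (x + y) = psi x * psi y.
Hypothesis psi0 : psi 0 = 1.
Hypothesis psi_nontriv : exists x, psi x != 1.
Hypothesis odd_char : ~~ (2%N \in [pchar F]).
Let gN0 := gauss_neq0 psiD psi0 psi_nontriv.
Let g0N0 := gauss0_neq0 psiD psi0 psi_nontriv.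
Let lphi := quad_char_lin odd_char.
Let two := two_neq0 odd_char.

(** A Kloosterman sum twisted by [a^-1 * phi]; the 4 and the [phi] come from completing a square.
    The term [y = 0] vanishes with the character. *)
Definition kloosterman a z := \sum_y chev (a^-1 * phi) y * psi (- y - z / (4%:R * y)).

Lemma four_neq0 : 4%:R != 0 :> F.
Proof. by rewrite (natrM _ 2 2) mulf_neq0. Qed.

(** [gauss_dilate] opens [chev a (s ^+ 2 - 1)] as a sum over [y], which makes the sum over [s] a
    quadratic Gauss sum. *)
Lemma bessel_kloosterman a z : a \is a linear_char -> a != 1 ->
  (\sum_s psi (z * s) * chev a (s ^+ 2 - 1)) * g a^-1 = g phi * kloosterman a (z ^+ 2).
Proof.
move=> la a1; have laV : a^-1 \is a linear_char by lin.
transitivity (- \sum_y chev a^-1 y * psi (- y) * \sum_s psi (y * s ^+ 2 + z * s)).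
  rewrite mulr_suml -sumrN; under [RHS]eq_bigr do rewrite mulr_sumr -sumrN.
  rewrite [RHS]exchange_big /=; apply: eq_bigr => s _.
  have := gauss_dilate psi0 (s ^+ 2 - 1) laV; rewrite invr_eq1 invrK => /(_ a1) E.
  rewrite -mulrA -[chev a _ * _]opprK -E mulrN mulr_sumr -sumrN; apply: eq_bigr => y _.
  have -> : y * (s ^+ 2 - 1) = - y + y * s ^+ 2 by ring.
  by rewrite !psiD; ring.
rewrite /kloosterman mulr_sumr -sumrN; apply: eq_bigr => y _.
have [->|y0] := eqVneq y 0; first by rewrite !chev0 !mul0r mulr0 oppr0.
have y2 : 2%:R * y != 0 by rewrite mulf_neq0.
have f0 := four_neq0.
(* Completing the square: the shift by [- z / (2 y)] removes the linear term in [s] and leaves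
   [- z ^+ 2 / (4 y)]. *)
transitivity (- (chev a^-1 y * psi (- y) * (psi (- (z ^+ 2 / (4%:R * y))) * \sum_s psi (y * s ^+ 2)))).
  congr (- (_ * _)); rewrite -(sum_shift _ (- z / (2%:R * y))) mulr_sumr; apply: eq_bigr => s _.
  by rewrite -psiD; congr psi; gfield.
rewrite (sum_square odd_char (fun u => psi (y * u))).
have -> : \sum_u (1 + chev phi u) * psi (y * u) = - (chev phi y * g phi).
  have := gauss_dilate psi0 y lphi (quad_char_neq1 odd_char).
  rewrite quad_charV // => <-.
  under eq_bigr do rewrite mulrDl mul1r; rewrite big_split /=.
  rewrite (sum_dilate psi y0) sum_psi // add0r; apply: eq_bigr => u _.
  by rewrite (mulrC y); ring.
by rewrite chevM psiD; ring.
Qed.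

(** With [r = (s + 1) / 2] one has [r * (r - 1) = (s ^+ 2 - 1) / 4]; the same [a] in both factors
    lets them merge. *)
Lemma sum_bessel a x t : a \is a linear_char -> x != 0 ->
  \sum_r psi (t * r / x) * chev a (t * r / x) * chev a (r - 1) =
  psi (t / (2%:R * x)) * chev a (t / (4%:R * x)) *
  \sum_s psi (t / (2%:R * x) * s) * chev a (s ^+ 2 - 1).
Proof.
move=> la x0; have f0 := four_neq0; have i2 := invr_neq0 two.
rewrite -(sum_dilate _ i2) -(sum_shift _ 1) mulr_sumr; apply: eq_bigr => s _.
have -> : t * (2%:R^-1 * (s + 1)) / x = t / (2%:R * x) + t / (2%:R * x) * s by gfield.
rewrite psiD -!mulrA; congr (_ * _); rewrite [RHS]mulrCA; congr (_ * _).
rewrite -!(chevMr la); congr (chev a _).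
have e4 : (4%:R : F) = 2%:R * 2%:R by rewrite -natrM.
by rewrite e4; gfield.
Qed.

End BesselKloosterman.

(** * The Mellin transform of a product of two Kloosterman sums *)

Section KloostermanPair.
Variables (F : finFieldType) (psi : F -> algC).
Implicit Types (a b c d e f nu : 'CF(Fx F)) (x y z : F).
Local Notation q := (qC F).
Local Notation g := (gauss psi).
Local Notation g0 := (gauss0 psi).
Local Notation phi := (quad_char F).
Local Notation kl := (kloosterman psi).
Hypothesis psiD : forall x y, psi (x + y) = psi x * psi y.
Hypothesis psi0 : psi 0 = 1.
Hypothesis psi_nontriv : exists x, psi x != 1.
Hypothesis odd_char : ~~ (2%N \in [pchar F]).
Let gN0 := gauss_neq0 psiD psi0 psi_nontriv.
Let g0N0 := gauss0_neq0 psiD psi0 psi_nontriv.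
Let lphi := quad_char_lin odd_char.
Let four := four_neq0 odd_char.

(** With both sums opened in [s] and [t], the sum over [u] is a Gauss sum of [d]. After [t = s * w]
    the sum over [s] is a Gauss sum of [e], the two twists by [phi] cancelling. *)
Lemma sum_kloosterman_pair a1 a2 d e x y : a1 \is a linear_char -> a2 \is a linear_char ->
    d \is a linear_char -> e = a1^-1 * a2^-1 * d -> d != 1 -> e != 1 ->
  \sum_u chev d u * (kl a1 (u * x) * kl a2 (u * y)) =
  chev d (-1) * chev e (-1) * g d * g e *
  \sum_w chev (a2^-1 * phi * d) w * chev d^-1 ((x * w + y) / 4%:R) * chev e^-1 (1 + w).
Proof.
move=> la1 la2 ld eE d1 e1; have le : e \is a linear_char by rewrite eE; lin.
have [la1V la2V] : a1^-1 \is a linear_char /\ a2^-1 \is a linear_char by split; lin.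
have [ldV leV] : d^-1 \is a linear_char /\ e^-1 \is a linear_char by split; lin.
pose A s := chev (a1^-1 * phi) s * psi (- s).
pose B t := chev (a2^-1 * phi) t * psi (- t).
transitivity (\sum_s \sum_t A s * B t *
    \sum_u psi (u * - (x / (4%:R * s) + y / (4%:R * t))) * chev d u).
  under eq_bigr do rewrite /kl mulr_suml mulr_sumr.
  rewrite exchange_big; apply: eq_bigr => s _ /=.
  under eq_bigr do rewrite 2!mulr_sumr.
  rewrite exchange_big; apply: eq_bigr => t _ /=.
  rewrite mulr_sumr; apply: eq_bigr => u _; rewrite /A /B.
  rewrite mulrN mulrDr opprD !psiD !(mulrA u); ring.
transitivity (- g d * \sum_w \sum_(s | s != 0) A s * B (s * w) *
    chev d^-1 (- (x / (4%:R * s) + y / (4%:R * (s * w))))).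
  rewrite [X in _ = _ * X]exchange_big mulr_sumr (bigD1 0) //= big1 => [|t _]; last first.
    by rewrite /A chev0 !mul0r.
  rewrite add0r; apply: eq_bigr => s s0.
  rewrite -(sum_dilate _ s0) mulr_sumr; apply: eq_bigr => w _.
  by rewrite (gauss_dilate psi0) //; ring.
rewrite !mulr_sumr; apply: eq_bigr => w _.
have [->|w0] := eqVneq w 0.
  rewrite [in RHS]chev0 !mul0r mulr0 big1 ?mulr0 // => s _.
  by rewrite /B mulr0 chev0 mul0r mulr0 mul0r.
transitivity (- g d * (chev d (-1) * chev (a2^-1 * phi * d) w * chev d^-1 ((x * w + y) / 4%:R) *
    \sum_s psi (s * - (1 + w)) * chev e s)).
  congr (_ * _); rewrite [in RHS](bigD1 0) //= chev0 mulr0 add0r mulr_sumr.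
  apply: eq_bigr => s s0; rewrite /A /B.
  have -> : - (x / (4%:R * s) + y / (4%:R * (s * w))) =
     - ((x * w + y) / 4%:R * (s * w)^-1) by gfield.
  rewrite (chevN ldV) (chevMr ldV _ (s * w)^-1) (chevV ld (-1)) chev_signV //
    (chevVr ldV) (chevV ld (s * w)) invrK.
  have -> : s * - (1 + w) = - s + - (s * w) by ring.
  rewrite psiD eE !chevM (chevMr la2V) (chevMr lphi) (chevMr ld).
  have phi2 : chev phi s ^+ 2 = 1.
    by rewrite expr2 -chevM quad_char_sqr // chev_triv s0.
  by ring: phi2.
rewrite (gauss_dilate psi0) // (chevN leV (1 + w)) (chevV le (-1)) chev_signV //.
by ring.
Qed.

(** The substitution [w = v^-1 - 1] gives the Euler integral of a 2F1 at [(x - y) / x]. *)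
Lemma sum_euler_pair d e h k x y : d \is a linear_char -> e \is a linear_char ->
    h \is a linear_char -> k = h^-1 * d * e -> x != 0 ->
  \sum_w chev h w * chev d^-1 ((x * w + y) / 4%:R) * chev e^-1 (1 + w) =
  chev d^-1 (x / 4%:R) *
  \sum_v chev k v * chev h (1 - v) * chev d^-1 (1 - (x - y) / x * v).
Proof.
move=> ld le lh kE x0.
have [ldV leV] : d^-1 \is a linear_char /\ e^-1 \is a linear_char by split; lin.
rewrite -(sum_shift _ (-1)) (reindex_inj invr_inj) mulr_sumr; apply: eq_bigr => v _ /=.
(* As [0^-1 = 0], [v = 0] stands for [w = -1], where [chev e^-1 (1 + w)] vanishes, as [chev k v]
   does on the right. *)
have [->|v0] := eqVneq v 0.
  by rewrite invr0 sub0r subrr chev0 mulr0 kE !chevM chev0 mulr0 !mul0r mulr0.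
have -> : (x * (v^-1 - 1) + y) / 4%:R = x / 4%:R * (1 - (x - y) / x * v) / v by gfield.
have -> : v^-1 - 1 = (1 - v) / v by gfield.
have -> : 1 + (1 - v) / v = v^-1 by gfield.
rewrite (chevMr ldV _ v^-1) (chevMr ldV (x / 4%:R)) (chevMr lh) (chevVr lh) (chevVr ldV) (chevVr leV).
rewrite (chevV ld v) (chevV le v) !invrK kE !chevM (chevV lh); ring.
Qed.

End KloostermanPair.

(** * The quadratic transformation of the Appell function into two 2F1 *)

Section QuadraticTransformation.
Variables (F : finFieldType) (psi : F -> algC).
Implicit Types (a b c d e f nu : 'CF(Fx F)) (x y z : F).
Local Notation q := (qC F).
Local Notation g := (gauss psi).
Local Notation g0 := (gauss0 psi).
Local Notation phi := (quad_char F).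
Local Notation kl := (kloosterman psi).
Hypothesis psiD : forall x y, psi (x + y) = psi x * psi y.
Hypothesis psi0 : psi 0 = 1.
Hypothesis psi_nontriv : exists x, psi x != 1.
Hypothesis odd_char : ~~ (2%N \in [pchar F]).
Let gN0 := gauss_neq0 psiD psi0 psi_nontriv.
Let g0N0 := gauss0_neq0 psiD psi0 psi_nontriv.
Let gV := gaussV psiD psi0 psi_nontriv.
Let lphi := quad_char_lin odd_char.

(** The Euler integral of the pair sum is a character sum by [sum_jacobi2]; shifting its character
    by [c * c] produces the 2F1 with lower parameter [c * c]. *)
Lemma kloosterman_pair_2F1 b1 b2 c x y : b1 \is a linear_char -> b2 \is a linear_char ->
    c \is a linear_char ->
    b1 * b2 * c^-1 != 1 -> b1 * b2 * c != 1 -> b1^-1 * b2 * c * phi != 1 -> x != 0 -> x != y ->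
  \sum_u chev (b1 * b2 * c^-1) u * (kl (b1 * b1) (u * x) * kl (b2 * b2) (u * y)) =
  - (chev (b1 * b2 * c^-1)^-1 (x / 4%:R) * chev (c * c) ((x - y) / x) * q ^+ 2 *
     chev phi (-1) / g0 (c * c)) *
  hypF psi [:: b1 * b2 * c; b1^-1 * b2 * c * phi] [:: c * c] ((x - y) / x).
Proof.
move=> lb1 lb2 lc d1 e1 h1 x0 xy; set z := (x - y) / x.
have z0 : z != 0 by rewrite mulf_neq0 ?invr_neq0 // subr_eq0.
(* With [phi^-1] inside [h], the identities left to [chareq] hold without using [phi * phi = 1]. *)
rewrite -(quad_charV odd_char) in h1 *.
pose d := b1 * b2 * c^-1; pose e := b1 * b2 * c; pose h := b1^-1 * b2 * c * phi^-1.
have ld : d \is a linear_char by rewrite /d; lin.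
have le : e \is a linear_char by rewrite /e; lin.
have lh : h \is a linear_char by rewrite /h; lin.
have leV : e^-1 \is a linear_char by lin.
have lhV : h^-1 \is a linear_char by lin.
have ldV : d^-1 \is a linear_char by lin.
pose k := h * d * e^-1; have lk : k \is a linear_char by rewrite /k; lin.
have lcc : c * c \is a linear_char by lin.
have la1 : b1 * b1 \is a linear_char by lin.
have la2 : b2 * b2 \is a linear_char by lin.
rewrite (@sum_kloosterman_pair _ _ psiD psi0 _ _ _ _ e^-1) // -/d -/e ?invr_eq1 //; last first.
  by rewrite /d /e; chareq.
have -> : (b2 * b2)^-1 * phi * d = h^-1 by rewrite /d /h; chareq.
rewrite (sum_euler_pair odd_char (k := k)) //; last by rewrite /k; chareq.
set E := \sum_v _.
have JE : (q - 1) * E = chev d^-1 (-1) * g d^-1 * g h^-1 * chev (c * c) z *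
    \sum_(i : Iirr (Fx F)) g (e * 'chi_i) * g (h * 'chi_i) / (g0 'chi_i * g0 (c * c * 'chi_i))
      * chev 'chi_i z.
  rewrite -sum_jacobi2 //.
  pose f nu := g (d * nu) * g (k * nu) / (g0 nu * g0 (k * h^-1 * nu)) * chev nu z.
  transitivity (chev d^-1 (-1) * g d^-1 * g h^-1 * \sum_(i : Iirr (Fx F)) f 'chi_i).
    rewrite mulr_sumr; apply: eq_bigr => i _; have li := chi_lin i.
    have lki : k * 'chi_i \is a linear_char by lin.
    rewrite (jacobi_chiV psiD psi0 psi_nontriv li ldV) ?invr_eq1 //.
    rewrite (jacobiE psiD psi0 psi_nontriv lki lhV) ?invr_eq1 ?h1 ?orbT //.
    have -> : d^-1^-1 * 'chi_i = d * 'chi_i by chareq.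
    have -> : k * 'chi_i * h^-1 = k * h^-1 * 'chi_i by chareq.
    have m1 : g0 'chi_i != 0 by apply: g0N0.
    have m2 : g0 (k * h^-1 * 'chi_i) != 0 by apply: g0N0; lin.
    by rewrite /f; gfield.
  (* The shift sends [d] to [e], [k] to [h] and [k * h^-1] to 1, and brings out [chev (c * c) z]. *)
  rewrite (reindex_chi f lcc) -[RHS]mulrA [X in _ = _ * X]mulr_sumr; congr (_ * _).
  apply: eq_bigr => i _; have li := chi_lin i; rewrite /f.
  have -> : d * (c * c * 'chi_i) = e * 'chi_i by rewrite /d /e; chareq.
  have -> : k * (c * c * 'chi_i) = h * 'chi_i by rewrite /k /d /e; chareq.
  have -> : k * h^-1 * (c * c * 'chi_i) = 'chi_i by rewrite /k /d /e; chareq.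
  have m1 : g0 'chi_i != 0 by apply: g0N0.
  have m2 : g0 (c * c * 'chi_i) != 0 by apply: g0N0; lin.
  by rewrite [chev (c * c * _) z]chevM; gfield.
rewrite (hypF21E psiD psi0 psi_nontriv) //; move: JE; set T := \sum_(i : Iirr _) _ => JE.
have q0 := qC_neq0 F; have q1 : 1 - q != 0 by rewrite -opprB oppr_eq0 qC_neq1.
have {JE} -> : E = chev d^-1 (-1) * g d^-1 * g h^-1 * chev (c * c) z * T / (q - 1).
  by rewrite -JE mulrC mulKf ?qC_neq1.
rewrite (chevV ld (-1)) (chevV le (-1)) (gV ld) (gV le) (gV lh) -/h.
rewrite (gauss0_neq1 _ d1) (gauss0_neq1 _ e1) (gauss0_neq1 _ h1).
have q2 := qC_neq1 F.
have [u1 u2 u3 u4] := And4 (gN0 ld) (gN0 le) (gN0 lh) (g0N0 lcc).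
have dh : chev d (-1) * chev h (-1) = chev phi^-1 (-1).
  rewrite -chevM; have -> : d * h = b2 * b2 * phi^-1 by rewrite /d /h; chareq.
  by rewrite chevM chevM chev_sign2 // mul1r.
rewrite -dh.
have s1 : chev e (-1) != 0 by rewrite chev_neq0 // oppr_eq0 oner_eq0.
have s2 : chev d (-1) != 0 by rewrite chev_neq0 // oppr_eq0 oner_eq0.
have s3 : chev d (-1) ^+ 2 = 1 by rewrite expr2 chev_sign2.
move: (chev e (-1)) (chev d (-1)) s1 s2 s3 (chev h (-1)) => e1' e2' s1 s2 s3 e3'.
field: s3.
by repeat (apply/andP; split).
Qed.

Lemma hypF_swap a b c x : hypF psi [:: a; b] [:: c] x = hypF psi [:: b; a] [:: c] x.
Proof.
rewrite /hypF; congr (_ * _); apply: eq_bigr => i _.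
by rewrite !big_cons !big_nil !mulr1 [poch _ a _ * _]mulrC.
Qed.

Lemma hypF_arg0 (s t : seq 'CF(Fx F)) : hypF psi s t 0 = 0.
Proof. by rewrite /hypF big1 ?mulr0 // => i _; rewrite chev0 mulr0. Qed.

Lemma appellF3_arg0 a1 a2 b1 b2 c y : appellF3 psi a1 a2 b1 b2 c 0 y = 0.
Proof.
rewrite /appellF3 big1 ?mulr0 // => i _.
by rewrite big1 // => j _; rewrite chev0 mulr0 mul0r.
Qed.

(** Squaring each forbidden equality contradicts a hypothesis. Only [c * c = d] enters, so the lemma
    serves [c] and [c * phi] alike. *)
Lemma quadratic_neq1 b1 b2 c d : b1 \is a linear_char -> b2 \is a linear_char ->
    c \is a linear_char -> d \is a linear_char -> c * c = d ->
    (b1 * b2) ^+ 2 != d -> (b1 * b2) ^+ 2 != d^-1 -> (b1 * b2^-1) ^+ 2 != d ->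
  [/\ b1 * b2 * c^-1 != 1, b1 * b2 * c != 1 & b1^-1 * b2 * c * phi != 1].
Proof.
move=> lb1 lb2 lc ld cd; rewrite -!cd => n1 n2 n3; split.
- apply: contra n1 => /eqP E; apply/eqP.
  transitivity (c * c * ((b1 * b2 * c^-1) * (b1 * b2 * c^-1))); first by chareq.
  by rewrite E !mulr1.
- apply: contra n2 => /eqP E; apply/eqP.
  transitivity ((c * c)^-1 * ((b1 * b2 * c) * (b1 * b2 * c))); first by chareq.
  by rewrite E !mulr1.
apply: contra n3 => /eqP E; apply/eqP.
transitivity ((phi * phi) * (c * c) * ((b1^-1 * b2 * c * phi) * (b1^-1 * b2 * c * phi))^-1).
  by chareq.
by rewrite E quad_char_sqr // mulr1 invr1 mulr1 mul1r.
Qed.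

(** Both confluent sums are Bessel sums, hence Kloosterman sums in [t ^+ 2]; [sum_square] then
    yields two pair sums, for [c] and [c * phi]. *)
Lemma appellF3_quadratic b1 b2 c x : b1 \is a linear_char -> b2 \is a linear_char ->
    c \is a linear_char -> b1 * b1 != 1 -> b2 * b2 != 1 ->
    (b1 * b2) ^+ 2 != c * c -> (b1 * b2) ^+ 2 != (c * c)^-1 -> (b1 * b2^-1) ^+ 2 != c * c ->
    x != 1 -> x != -1 ->
  appellF3 psi (b1 * b1) (b2 * b2) (b1 * b1)^-1 (b2 * b2)^-1 (c * c) (x / (x + 1)) (x / (x - 1)) =
  chev (b2 * b2 * (c * c))^-1 (1 + x) * chev (b2 * b2) (1 - x) *
  \sum_(c' <- [:: c; c * phi])
    hypF psi [:: b1^-1 * b2 * c'; b1 * b2 * c' * phi] [:: c * c] (4%:R * x / (x + 1) ^+ 2).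
Proof.
move=> lb1 lb2 lc a1N a2N n1 n2 n3 x1 xN1.
have [->|x0] := eqVneq x 0.
  by rewrite !(mul0r, mulr0) appellF3_arg0 !(big_cons, big_nil, hypF_arg0, addr0) mulr0.
have lcf : c * phi \is a linear_char by lin.
have lcc : c * c \is a linear_char by lin.
have ccf : (c * phi) * (c * phi) = c * c.
  transitivity (c * c * (phi * phi)); first by chareq.
  by rewrite quad_char_sqr // mulr1.
have [m1 m2 m3] := quadratic_neq1 lb1 lb2 lc lcc erefl n1 n2 n3.
have [k1 k2 k3] := quadratic_neq1 lb1 lb2 lcf lcc ccf n1 n2 n3.
have la1 : b1 * b1 \is a linear_char by lin.
have la2 : b2 * b2 \is a linear_char by lin.
(* Opaque names keep these squares whole when [chevM] is rewritten everywhere. *)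
have [a1 a1E] : exists a, b1 * b1 = a by exists (b1 * b1).
have [a2 a2E] : exists a, b2 * b2 = a by exists (b2 * b2).
rewrite a1E in a1N la1 *; rewrite a2E in a2N la2 *.
have la1V : a1^-1 \is a linear_char by lin.
have la2V : a2^-1 \is a linear_char by lin.
have y1 : x + 1 != 0 by rewrite addr_eq0.
have y2 : x - 1 != 0 by rewrite subr_eq0.
have t2 := two_neq0 odd_char; have t4 := four_neq0 odd_char.
(* Half the inverses of the two arguments of the Appell function. They satisfy [p + m = 1] and
   [p ^+ 2 - m ^+ 2 = x^-1]. *)
pose p := (x + 1) / (2%:R * x); pose m := (x - 1) / (2%:R * x).
rewrite (appellF3_integral psiD psi0 psi_nontriv) ?invr_eq1 // ?mulf_neq0 ?invr_neq0 // !invrK.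
pose D u := chev (b1 * b2 * c^-1) u * (kl a1 (u * p ^+ 2) * kl a2 (u * m ^+ 2)).
set S := \sum_t _.
have e4 : (4%:R : F) = 2%:R * 2%:R by rewrite -natrM.
have gf : g phi * g phi = chev phi (-1) * q.
  rewrite -(gauss_gauss0V psiD psi0 psi_nontriv lphi) quad_charV //.
  by rewrite gauss0_neq1 ?quad_char_neq1.
have gaV a : a \is a linear_char -> a != 1 -> chev a (-1) = 1 -> g a^-1 = q / g a.
  by move=> la aN a_1; rewrite (gV la) a_1 mul1r gauss0_neq1.
have a1s : chev a1 (-1) = 1 by rewrite -a1E chevM chev_sign2.
have a2s : chev a2 (-1) = 1 by rewrite -a2E chevM chev_sign2.
have [u1 u2 u3 q0] := And4 (gN0 la1) (gN0 la2) (g0N0 lcc) (qC_neq0 F).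
have SE : S = chev a1 (p / 2%:R) * chev a2 (m / 2%:R) * (chev phi (-1) * q / (g a1^-1 * g a2^-1)) *
   \sum_t D (t ^+ 2).
  rewrite mulr_sumr; apply: eq_bigr => t _.
  rewrite !(sum_bessel psiD odd_char) ?mulf_neq0 ?invr_neq0 //.
  have -> : t / (2%:R * (x / (x + 1))) = t * p by rewrite /p; gfield.
  have -> : t / (2%:R * (x / (x - 1))) = t * m by rewrite /m; gfield.
  have -> : t / (4%:R * (x / (x + 1))) = t * (p / 2%:R) by rewrite /p e4; gfield.
  have -> : t / (4%:R * (x / (x - 1))) = t * (m / 2%:R) by rewrite /m e4; gfield.
  have B1 := bessel_kloosterman psiD psi0 psi_nontriv odd_char (t * p) la1 a1N.
  have B2 := bessel_kloosterman psiD psi0 psi_nontriv odd_char (t * m) la2 a2N.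
  have g1 : g a1^-1 != 0 by apply: gN0.
  have g2 : g a2^-1 != 0 by apply: gN0.
  rewrite (canRL (mulfK g1) B1) (canRL (mulfK g2) B2) -gf /D !exprMn.
  have [->|t0] := eqVneq t 0; first by rewrite expr0n /= !chev0 mulr0 !mul0r mulr0.
  (* Since [p + m = 1] the additive factors cancel, leaving a function of [t ^+ 2]. *)
  have P : psi (- t) * psi (t * p) * psi (t * m) = 1.
    by rewrite -!psiD -psi0; congr psi; rewrite /p /m; gfield.
  rewrite (chevMr la1 t) (chevMr la2 t) (chevV lcc) !chevM (chevV lc) expr2.
  rewrite (chevMr lb1 t) (chevMr lb2 t) (chevMr lc t).
  have -> : chev a1 t = chev b1 t * chev b1 t by rewrite -a1E chevM.
  have -> : chev a2 t = chev b2 t * chev b2 t by rewrite -a2E chevM.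
  have ct := chev_neq0 lc t0.
  move: P; move: (psi _) (psi _) (psi _) => P1 P2 P3 P; field: P.
  by repeat (apply/andP; split).
(* The weight [chev phi u] of [sum_square] is absorbed by replacing [c] with [c * phi]. *)
have YE : \sum_t D (t ^+ 2) =
  \sum_u chev (b1 * b2 * c^-1) u * (kl a1 (u * p ^+ 2) * kl a2 (u * m ^+ 2)) +
  \sum_u chev (b1 * b2 * (c * phi)^-1) u * (kl a1 (u * p ^+ 2) * kl a2 (u * m ^+ 2)).
  rewrite (sum_square odd_char D) -big_split; apply: eq_bigr => u _ /=.
  have -> : b1 * b2 * (c * phi)^-1 = phi * (b1 * b2 * c^-1).
    by transitivity (phi^-1 * (b1 * b2 * c^-1)); [chareq|rewrite quad_charV].
  by rewrite /D [chev (phi * _) u]chevM; ring.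
have p0 : p != 0 by rewrite mulf_neq0 ?invr_neq0 ?mulf_neq0.
have pm : p ^+ 2 - m ^+ 2 = x^-1 by rewrite /p /m; field: e4; rewrite t2 x0.
have zE : (p ^+ 2 - m ^+ 2) / p ^+ 2 = 4%:R * x / (x + 1) ^+ 2.
  by rewrite pm /p e4; gfield.
have dE c' : c' \is a linear_char -> c' * c' = c * c ->
   chev (b1 * b2 * c'^-1)^-1 (p ^+ 2 / 4%:R) =
   chev (c * c) (p / 2%:R) / (chev a1 (p / 2%:R) * chev a2 (p / 2%:R)).
  move=> lc' cc'; have -> : p ^+ 2 / 4%:R = p / 2%:R * (p / 2%:R) by rewrite e4; gfield.
  have lV : (b1 * b2 * c'^-1)^-1 \is a linear_char by lin.
  rewrite (chevMr lV) -chevM -(chevM a1) -chevV; last by lin.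
  rewrite -chevM -cc'; congr (chev _ _); rewrite -a1E -a2E; chareq.
have px : p ^+ 2 != 0 by rewrite expf_neq0.
have pxy : p ^+ 2 != m ^+ 2 by rewrite -subr_eq0 pm invr_neq0.
have := kloosterman_pair_2F1 lb1 lb2 lc m1 m2 m3 px pxy.
have := kloosterman_pair_2F1 lb1 lb2 lcf k1 k2 k3 px pxy.
rewrite a1E a2E => K2 K1.
rewrite {}SE {}YE {}K1 {}K2 zE !dE // ccf.
have -> : b1 * b2 * (c * phi) = b1 * b2 * c * phi by chareq.
have -> : b1^-1 * b2 * (c * phi) * phi = b1^-1 * b2 * c.
  transitivity (b1^-1 * b2 * c * (phi * phi)); first by chareq.
  by rewrite quad_char_sqr // mulr1.
rewrite big_cons big_seq1.
have -> : b1^-1 * b2 * (c * phi) = b1^-1 * b2 * c * phi by chareq.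
have -> : b1 * b2 * (c * phi) * phi = b1 * b2 * c.
  transitivity (b1 * b2 * c * (phi * phi)); first by chareq.
  by rewrite quad_char_sqr // mulr1.
(* The two terms cross over: the pair sum for [c] gives the summand [c' = c * phi], and the one for
   [c * phi] gives [c' = c]. *)
rewrite [hypF _ [:: b1 * b2 * c; _] _ _]hypF_swap [hypF _ [:: b1 * b2 * c * phi; _] _ _]hypF_swap.
move: (hypF _ _ _ _) (hypF _ _ _ _) => H1 H2.
have w0 : p / 2%:R != 0 by rewrite mulf_neq0 ?invr_neq0.
have -> : 4%:R * x / (x + 1) ^+ 2 = (p / 2%:R)^-1 / (x + 1) by rewrite /p e4; gfield.
have -> : m / 2%:R = p / 2%:R * (x - 1) / (x + 1) by rewrite /p /m; gfield.
have la2c : a2 * (c * c) \is a linear_char by lin.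
rewrite -[1 - x]opprB (chevN la2) a2s mul1r (addrC 1 x) (chevV la2c) (chevM a2 (c * c)).
rewrite (chevMr la2 _ (x + 1)^-1) (chevMr la2 _ (x - 1)) (chevVr la2).
rewrite (chevMr lcc _ (x + 1)^-1) !(chevVr lcc) (gaV _ la1) // (gaV _ la2) //.
have s1 : chev phi (-1) ^+ 2 = 1 by rewrite expr2 chev_sign2.
have [v1 v2 v3] := And3 (chev_neq0 la1 w0) (chev_neq0 la2 w0) (chev_neq0 lcc w0).
have [v4 v5] := conj (chev_neq0 la2 y1) (chev_neq0 lcc y1).
field: s1.
by repeat (apply/andP; split).
Qed.

End QuadraticTransformation.

(** * The three evaluations for irreducible characters, with the degenerate case of a zero [psi] *)

Unset Implicit Arguments.
Theorem theorem3p14 (F : finFieldType) (psi : F -> algC) (Hpsi : nontriv_add_char psi)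
    (a1 a2 b1 b2 c : Iirr (Fx F)) :
  let A1 := 'chi_a1 in let A2 := 'chi_a2 in let B1 := 'chi_b1 in
  let B2 := 'chi_b2 in let C := 'chi_c in
  (* (i) *)
  ((A1 != 1) -> (A2 != 1) -> (B2 != 1) -> ((B1 * B2)^-1 * C != 1) ->
   forall lam : F,
   appellF3 psi A1 A2 B1 B2 C lam 1 =
     gauss0 psi C * gauss psi ((A2 * B2)^-1 * C)
     / (gauss0 psi (A2^-1 * C) * gauss0 psi (B2^-1 * C))
     * hypF psi [:: A1; B1; (A2 * B2)^-1 * C] [:: A2^-1 * C; B2^-1 * C] lam)
  /\
  (* (ii) *)
  ((A1 != 1) -> (A2 != 1) -> (B1 != 1) -> (B2 != 1) -> ((A1 * A2)^-1 * C != 1) ->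
   forall lam : F, lam != 1 ->
   appellF3 psi A1 A2 B1 B2 C lam (lam / (lam - 1)) =
     gauss psi (A1 * A2 * C^-1) * gauss psi (A2 * B1 * C^-1) * gauss psi B2^-1
     / (gauss psi C^-1 * gauss0 psi (A1 * A2 * B1 * C^-1) * gauss0 psi (A2 * B2^-1))
     * chev C^-1 lam * chev A2 (1 - lam)
     * hypF psi [:: A1 * A2 * C^-1; A2 * B1 * C^-1; B2^-1]
                [:: A1 * A2 * B1 * C^-1; A2 * B2^-1] (1 - lam))
  /\
  (* (iii) *)
  (~~ (2%N \in [pchar F]) -> (B1 ^+ 2 != 1) -> (B2 ^+ 2 != 1) ->
   ((B1 * B2) ^+ 2 != C ^+ 2) -> ((B1 * B2) ^+ 2 != (C ^+ 2)^-1) ->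
   ((B1 * B2^-1) ^+ 2 != C ^+ 2) -> ((B1 * B2^-1) ^+ 2 != (C ^+ 2)^-1) ->
   forall lam : F, lam != 1 -> lam != -1 ->
   appellF3 psi (B1 ^+ 2) (B2 ^+ 2) ((B1^-1) ^+ 2) ((B2^-1) ^+ 2) (C ^+ 2)
            (lam / (lam + 1)) (lam / (lam - 1)) =
     chev ((B2 ^+ 2 * C ^+ 2)^-1) (1 + lam) * chev (B2 ^+ 2) (1 - lam)
     * \sum_(C' <- [:: C; C * quad_char F])
         hypF psi [:: B1^-1 * B2 * C'; B1 * B2 * C' * quad_char F] [:: C ^+ 2]
              (4%:R * lam / (lam + 1) ^+ 2)).
Proof.
move=> A1 A2 B1 B2 C.
have [lA1 lA2 lB1 lB2 lC] :=
  And5 (chi_lin a1) (chi_lin a2) (chi_lin b1) (chi_lin b2) (chi_lin c).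
have [psiD psi_nontriv] := Hpsi.
(* The hypothesis on [psi] admits the zero function; then both sides vanish. *)
have [psi00|psi0N] := eqVneq (psi 0) 0.
  have g0' e : gauss psi e = 0.
    rewrite gaussE big1 ?oppr0 // => x _.
    by rewrite -[x]addr0 psiD psi00 mulr0 mul0r.
  have appell0 a a' b b' d x y : appellF3 psi a a' b b' d x y = 0.
    rewrite /appellF3 big1 ?mulr0 // => i _; rewrite big1 // => j _.
    by rewrite /poch !g0' !mul0r.
  split; [|split] => *; rewrite appell0 ?g0' ?mulr0 ?mul0r //.
  rewrite !big_cons big_nil /hypF !big1 ?mulr0 ?addr0 ?mulr0 // => i _;
    by rewrite big_cons /poch g0' !mul0r.
have psi0 : psi 0 = 1.
  by apply: (mulfI psi0N); rewrite -psiD addr0 mulr1.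
split; [|split].
- by move=> _ A2N B2N _ x; exact: appellF3_at1.
- by move=> A1N A2N B1N B2N CN x x1; exact: appellF3_clausen.
move=> odd_char B1N B2N n1 n2 n3 n4 x x1 xN1.
have EV (b : 'CF(Fx F)) : b \is a linear_char -> (b^-1) ^+ 2 = (b * b)^-1.
  by move=> lb; rewrite expr2; chareq.
rewrite !EV //; have [EB1 EB2 EC] := And3 (expr2 B1) (expr2 B2) (expr2 C).
rewrite EC in n1 n2 n3; rewrite EB1 in B1N *; rewrite EB2 in B2N *; rewrite EC.
exact: appellF3_quadratic.
Qed.
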